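(* Let $T>0$ and $H\in(0,\frac12)\cup(\frac12,1)$, and suppose that the covariance function $R$ of the Gaussian process $G$ satisfies Hypothesis (A) described in the context with constant $C_H'$. Then for all $\varphi,\psi\in(\mathcal V_{[0,T]})^{\odot2}$, $$\big|\langle\varphi,\psi\rangle_{\mathfrak H^{\otimes2}}-\langle\varphi,\psi\rangle_{\mathfrak H_1^{\otimes2}}\big|\le(C_H')^2\,(\mu\times\mu)(|\varphi|)\,(\mu\times\mu)(|\psi|)+2C_H'\,(\mu\times\mu)(|\varphi\otimes_{1'}\psi|),$$ where $\varphi\otimes_{1'}\psi$ is the first contraction of $\varphi$ and $\psi$ in $\mathfrak H_1^{\otimes2}$.
   Context: $G=(G_t)$ is a continuous centered Gaussian process with continuous covariance $R(t,s)=\mathbb E[G_tG_s]$. $\mathfrak H$ is the closure of the real step functions on $[0,T]$ under $\langle\mathbf 1_{[a,b)},\mathbf 1_{[c,d)}\rangle_{\mathfrak H}=\mathbb E[(G_b-G_a)(G_d-G_c)]$; $\mathfrak H_1$ is the same space built from fractional Brownian motion with Hurst parameter $H$, whose covariance is $R^B(t,s)=\frac12(t^{2H}+s^{2H}-|t-s|^{2H})$. $\mathcal V_{[0,T]}$ is the set of bounded variation functions on $[0,T]$, and $(\mathcal V_{[0,T]})^{\odot2}$ its symmetric second tensor power (symmetric functions of two variables). For $f,g\in\mathcal V_{[0,T]}$, $$\langle f,g\rangle_{\mathfrak H_1}=-\int_{[0,T]^2}f(t)\frac{\partial R^B(t,s)}{\partial t}\,\mathrm dt\,\nu_g(\mathrm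 ds),$$ where $\nu_g$ is the restriction to $[0,T]$ of the Lebesgue–Stieltjes signed measure associated with $g^0=g\mathbf 1_{[0,T)}$ (extended by $0$ to $\mathbb R$). $\mu(\mathrm dx)=x^{H-1}\,\mathrm dx$ on $[0,T]$ and $(\mu\times\mu)(f)=\int_{[0,T]^2}f\,\mathrm d(\mu\times\mu)$. For functions $\varphi,\psi$ of two variables, $(\varphi\otimes_{1'}\psi)(u_1,u_2)=\langle\varphi(u_1,\cdot),\psi(u_2,\cdot)\rangle_{\mathfrak H_1}$, i.e. the first contraction $\sum_i\langle\varphi,e_i\rangle_{\mathfrak H_1}\otimes\langle\psi,e_i\rangle_{\mathfrak H_1}$ over an orthonormal basis $(e_i)$ of $\mathfrak H_1$. Hypothesis (A). There is a constant $C_H'\ge0$ (not depending on $T$) such that: (1) $R(0,s)=0$ for all $s\ge0$; (2) for each fixed $s\in(0,T)$, $t\mapsto R(t,s)$ is continuous on $[0,T]$ and differentiable on $(0,s)\cup(s,T)$, with $\frac{\partial}{\partial t}R(t,s)$ absolutely integrable in $t$; (3) for each fixed $t\in(0,T)$, the difference $\frac{\partial R(t,s)}{\partial t}-\frac{\partial R^B(t,s)}{\partial t}$, as a function of $s$, is (extends across $s=t$ to) a continuous function on $[0,T]$, differentiable in $s\in(0,T)$, and its partial derivative with respect to $s$, denoted $\Psi(t,s)$, satisfies $|\Psi(t,s)|\le C_H'|ts|^{H-1}$. *)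

(* Defs.v *)
From HB Require Import structures.
From mathcomp Require Import all_boot all_order all_algebra.
From mathcomp Require Import all_classical all_reals all_analysis.

Set Implicit Arguments.
Unset Strict Implicit.
Unset Printing Implicit Defensive.

Import Order.TTheory GRing.Theory Num.Theory.
Import numFieldNormedType.Exports.

Local Open Scope classical_set_scope.
Local Open Scope ring_scope.

(* [normal_prob m 0] is not the point mass at m in the library, hence the
   case distinction. *)
Definition gaussian_law (R : realType) (m s : R) (A : set R) : \bar R :=
  if s == 0 then \d_m A else normal_prob m s A.

Definition gaussian_rv d (Omega : measurableType d) (R : realType)
    (P : probability Omega R) (X : Omega -> R) : Prop :=
  exists m s : R, forall A : set R, measurable A ->
    P (X @^-1` A) = gaussian_law m s A.

(* The process is indexed by [0, +oo[; its values at negative times are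
   irrelevant everywhere below. *)
Definition gaussian_process d (Omega : measurableType d) (R : realType)
    (P : probability Omega R) (G : R -> {RV P >-> R}) : Prop :=
  forall (n : nat) (c t : 'I_n -> R), (forall i, 0 <= t i) ->
    gaussian_rv P (fun w => \sum_(i < n) c i * G (t i) w).

Definition centered_process d (Omega : measurableType d) (R : realType)
    (P : probability Omega R) (G : R -> {RV P >-> R}) : Prop :=
  forall t : R, 0 <= t -> ('E_P[G t] = 0)%E.

Definition continuous_process d (Omega : measurableType d) (R : realType)
    (P : probability Omega R) (G : R -> {RV P >-> R}) : Prop :=
  {ae P, forall w, {within `[0, +oo[, continuous (fun t => G t w)}}.

Definition cov d (Omega : measurableType d) (R : realType)
    (P : probability Omega R) (G : R -> {RV P >-> R}) (t s : R) : R :=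
  fine ('E_P[(G t \* G s)%R])%E.

Definition continuous_cov (R : realType) (K : R -> R -> R) : Prop :=
  {within [set z : R * R | 0 <= z.1 /\ 0 <= z.2],
    continuous (fun z : R * R => K z.1 z.2)}.

Definition incr_cov d (Omega : measurableType d) (R : realType)
    (P : probability Omega R) (G : R -> {RV P >-> R}) (a b c e : R) : R :=
  fine ('E_P[((G b \- G a) \* (G e \- G c))%R])%E.

Definition RB (R : realType) (H t s : R) : R :=
  2^-1 * (t `^ (2 * H) + s `^ (2 * H) - `|t - s| `^ (2 * H)).

(* E[(B_b - B_a)(B_e - B_c)] for fractional Brownian motion B, expanded with
   E[B_t B_s] = RB H t s. *)
Definition incr_covB (R : realType) (H a b c e : R) : R :=
  RB H b e - RB H b c - RB H a e + RB H a c.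

Record hilbert (R : realType) := Hilbert {
  hilbert_space :> completeNormedModType R;
  ip : hilbert_space -> hilbert_space -> R;
  ipC : forall x y, ip x y = ip y x;
  ip_linear : forall (c : R) x y z, ip (c *: x + y) z = c * ip x z + ip y z;
  ip_norm : forall x, ip x x = `|x| ^+ 2
}.

Record tensor_square (R : realType) (E : hilbert R) := TensorSquare {
  tensor_hilbert :> hilbert R;
  tens : E -> E -> tensor_hilbert;
  tens_linearl : forall (c : R) x y z,
    tens (c *: x + y) z = c *: tens x z + tens y z;
  tens_linearr : forall (c : R) x y z,
    tens z (c *: x + y) = c *: tens z x + tens z y;
  tens_ip : forall x x' y y',
    ip (tens x x') (tens y y') = ip x y * ip x' y';
  tens_dense :
    closure [set h : tensor_hilbert | exists (n : nat) (u v : 'I_n -> E),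
               h = \sum_(i < n) tens (u i) (v i)] = setT
}.

Definition step_fun (R : realType) (T : R) (f : R -> R) : Prop :=
  exists (n : nat) (c a b : 'I_n -> R),
    (forall i, [/\ 0 <= a i, a i <= b i & b i <= T]) /\
    f = (fun x => \sum_(i < n) c i * \1_(`[a i, b i[%classic) x).

(* A Hilbert space in which the step functions on [0, T], with
   <1_[a,b), 1_[c,e)> = q a b c e, have dense image: unique up to isometry. *)
Record step_completion (R : realType) (T : R) (q : R -> R -> R -> R -> R) :=
  StepCompletion {
    sc_hilbert :> hilbert R;
    sc_class : (R -> R) -> sc_hilbert;
    sc_linear : forall (c : R) f g, step_fun T f -> step_fun T g ->
      sc_class (fun x => c * f x + g x) = c *: sc_class f + sc_class g;
    sc_ip : forall a b c e, 0 <= a -> a <= b -> b <= T ->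
      0 <= c -> c <= e -> e <= T ->
      ip (sc_class \1_(`[a, b[%classic)) (sc_class \1_(`[c, e[%classic))
        = q a b c e;
    sc_dense : closure [set sc_class f | f in step_fun T] = setT
  }.

Definition step_approx (R : realType) (T : R) (f : R -> R) (n : nat) : R -> R :=
  fun x => \sum_(k < n) f (k%:R / n%:R * T) *
    \1_(`[k%:R / n%:R * T, k.+1%:R / n%:R * T[%classic) x.

(* The element represented by a function f of bounded variation (its Wiener
   integral, in terms of the process): the limit of its left-endpoint step
   approximations. *)
Definition bv_class (R : realType) (T : R) q (E : @step_completion R T q)
    (f : R -> R) : E :=
  lim (sc_class E (step_approx T f n) @[n --> \oo]).

Definition tensor_repr (R : realType) (T : R) (phi : R -> R -> R)
    (n : nat) (f g : 'I_n -> R -> R) : Prop :=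
  (forall i, bounded_variation 0 T (f i) /\ bounded_variation 0 T (g i)) /\
  (forall x y, 0 <= x <= T -> 0 <= y <= T ->
     phi x y = \sum_(i < n) f i x * g i y).

(* The algebraic tensor square of the functions of bounded variation, as
   functions of two variables; its symmetric part is made of the symmetric
   functions. *)
Definition Vsym2 (R : realType) (T : R) (phi : R -> R -> R) : Prop :=
  (exists (n : nat) (f g : 'I_n -> R -> R), tensor_repr T phi f g) /\
  (forall x y, 0 <= x <= T -> 0 <= y <= T -> phi x y = phi y x).

Definition tensor_class (R : realType) (T : R) q (E : @step_completion R T q)
    (E2 : tensor_square E) (phi : R -> R -> R) (h : E2) : Prop :=
  exists (n : nat) (f g : 'I_n -> R -> R), tensor_repr T phi f g /\
    h = \sum_(i < n) tens E2 (bv_class E (f i)) (bv_class E (g i)).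

Definition zero_ext (R : realType) (T : R) (g : R -> R) : R -> R :=
  fun x => g x * \1_(`[0, T[%classic) x.

Definition is_LS_charge (R : realType) (F : R -> R)
    (nu : {charge set (measurableTypeR R) -> \bar R}) : Prop :=
  forall a b : R, a <= b ->
    nu `]a, b]%classic =
      (lim (F x @[x --> b^'+]) - lim (F x @[x --> a^'+]))%:E.

(* Such a charge exists and is unique when F has bounded variation on the whole
   line and vanishes near -oo. *)
Definition LS_charge (R : realType) (F : R -> R) :
    {charge set (measurableTypeR R) -> \bar R} :=
  match pselect (exists nu, is_LS_charge F nu) with
  | left e => projT1 (cid e)
  | right _ => czero
  end.

Definition charge_integral d (X : measurableType d) (R : realType)
    (nu : {charge set X -> \bar R}) (D : set X) (f : X -> R) : R :=
  let P := cid (Hahn_decomposition nu) in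
  let N := cid (projT2 P) in
  (\int[jordan_pos (projT2 N)]_(x in D) f x)
    - (\int[jordan_neg (projT2 N)]_(x in D) f x).

Definition dRB (R : realType) (H t s : R) : R :=
  derive1 (fun u : R => RB H u s) t.

Definition ipB (R : realType) (H T : R) (f g : R -> R) : R :=
  - charge_integral (LS_charge (zero_ext T g)) `[0, T]%classic
      (fun s => \int[lebesgue_measure]_(t in `[0, T]) (f t * dRB H t s)).

Definition contraction1 (R : realType) (H T : R) (phi psi : R -> R -> R) :
    R -> R -> R :=
  fun u1 u2 => ipB H T (phi u1) (psi u2).

(* (mu x mu)(f) with mu(dx) = x^(H-1) dx on [0, T] *)
Definition mu2 (R : realType) (H T : R) (f : R -> R -> R) : \bar R :=
  (\int[lebesgue_measure \x lebesgue_measure]_(z in `[0%R, T] `*` `[0%R, T])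
     (f z.1 z.2 * z.1 `^ (H - 1) * z.2 `^ (H - 1))%:E)%E.

(* In [hypA_diff], K is the difference of the two partial derivatives in t, as a
   function of s, extended across s = t. *)
Record hypA (R : realType) (K : R -> R -> R) (H T C : R) : Prop := HypA {
  hypA_C : 0 <= C;
  hypA_0 : forall s, 0 <= s -> K 0 s = 0;
  hypA_cont : forall s, 0 < s < T ->
    {within `[0, T], continuous (fun t => K t s)};
  hypA_diffble : forall s t, 0 < s < T -> 0 < t < T -> t != s ->
    derivable (fun u => K u s) t 1;
  hypA_int : forall s, 0 < s < T ->
    lebesgue_measure.-integrable `]0, T[
      (fun t => (derive1 (fun u => K u s) t)%:E);
  hypA_diff : forall t, 0 < t < T -> exists D : R -> R,
    [/\ {within `[0, T], continuous D},
        forall s, 0 <= s <= T -> s != t ->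
          derivable (fun u => K u s) t 1 /\
          D s = derive1 (fun u => K u s) t - dRB H t s
      & forall s, 0 < s < T ->
          derivable D s 1 /\ `|derive1 D s| <= C * `|t * s| `^ (H - 1)]
}.

(* Main.v *)
Require Import Defs.
From HB Require Import structures.
From mathcomp Require Import all_boot all_order all_algebra.
From mathcomp Require Import all_classical all_reals all_analysis.
From mathcomp Require Import measurable_realfun.
From mathcomp Require Import ring lra.

Set Implicit Arguments.
Unset Strict Implicit.
Unset Printing Implicit Defensive.

Import Order.TTheory GRing.Theory Num.Theory.
Import numFieldNormedType.Exports.

Local Open Scope classical_set_scope.
Local Open Scope ring_scope.

(** All the quantities are limits of sums over the uniform grids of [[0, T]] with
    [n] cells, and the inequality holds for each [n] at the level of these sums.

    In a completion of the step functions for a covariance [K], the step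
    approximations of a function of bounded variation are Riemann-Stieltjes sums
    of the curve formed by the classes of the indicators of [[0, t[], which is
    continuous because [K] is. Summation by parts makes such sums converge
    ([rs_sum_cauchy]), so that the inner product of two tensors is the limit of a
    quadruple sum [tensor_sum], built from the values of [phi] and [psi] on the
    grid and from the increments of [K] over rectangles ([tensor_ip_cvg]).

    The hypothesis on the process is used through [rect_bound]: the increment of
    the difference of the two covariances over a rectangle is at most [C] times
    the mass of this rectangle for [mu x mu]. This follows from two successive
    mean value inequalities, one in each variable. When the increments of [cov G]
    are written as those of [RB H] plus a perturbation, the quadruple sum becomes
    that of fractional Brownian motion, plus a term that is quadratic in the
    perturbation, plus two linear terms, which are equal because [phi] and [psi]
    are symmetric ([tensor_sum_diff]). In the linear terms the sum over the
    remaining two indices is a discrete contraction.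

    Then [n] tends to infinity. The sums of [|phi|] and [|psi|] tend to their
    integrals ([mu2_tensor_cvg]), by a one-dimensional estimate for weighted
    Riemann sums that is used in each variable ([weighted_riemann]). The discrete
    contractions tend to the contraction, which is defined by a
    Lebesgue-Stieltjes integral ([contraction_cvg]). For this one has to know
    that the Lebesgue-Stieltjes formula [ipB] is the limit of the double sums
    over the grid ([ipB_cvg]): the derivative of [RB H] has integrable
    singularities with explicit primitives ([primitive_dRB]), the charge of a
    function of bounded variation exists ([LS_chargeP]), and a summation by parts
    turns the sums into integrals against this charge. *)

(** * Uniform grids and functions of bounded variation *)

Definition grid (R : realType) (T : R) (n k : nat) : R := k%:R / n%:R * T.

Lemma grid0 (R : realType) (T : R) n : grid T n 0 = 0.
Proof. by rewrite /grid !mul0r. Qed.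

Lemma gridn (R : realType) (T : R) n : (0 < n)%N -> grid T n n = T.
Proof. by move=> n0; rewrite /grid divff ?mul1r// pnatr_eq0 -lt0n. Qed.

Lemma grid_le (R : realType) (T : R) n i j : 0 <= T -> (i <= j)%N ->
  grid T n i <= grid T n j.
Proof.
by move=> T0 ij; rewrite /grid ler_wpM2r// ler_wpM2r ?invr_ge0 ?ler_nat.
Qed.

Lemma grid_ge0 (R : realType) (T : R) n i : 0 <= T -> 0 <= grid T n i.
Proof. by move=> T0; rewrite -(grid0 T n) grid_le. Qed.

Lemma grid_leT (R : realType) (T : R) n i : 0 <= T -> (i <= n)%N ->
  grid T n i <= T.
Proof.
move=> T0; case: n => [|n] ni; first by rewrite /grid invr0 mulr0 mul0r.
by rewrite -[leRHS](@gridn _ T n.+1)// grid_le.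
Qed.

Lemma grid_step (R : realType) (T : R) n k :
  grid T n k.+1 - grid T n k = T / n%:R.
Proof. by rewrite /grid -!mulrBl -natrB ?leqnSn// subSn// subnn mul1r mulrC. Qed.

Lemma grid_mul (R : realType) (T : R) n m k : (0 < m)%N ->
  grid T (n * m) (k * m) = grid T n k.
Proof.
move=> m0; rewrite /grid !natrM -mulf_div divff ?mulr1//.
by rewrite pnatr_eq0 -lt0n.
Qed.

(** The total variation of [f] up to a point is such a [v]. This domination is
    stable under sums, products by constants and absolute values, and it bounds
    [f] and its oscillation over each cell of a grid. *)
Definition controls (R : realType) (T : R) (v f : R -> R) : Prop :=
  forall x y, 0 <= x -> x <= y -> y <= T -> `|f y - f x| <= v y - v x.

Lemma bounded_variation_controls (R : realType) (T : R) (f : R -> R) :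
  0 <= T -> bounded_variation 0 T f -> exists v, controls T v f.
Proof.
move=> T0 bv; exists (fun x => fine (total_variation 0 x f)) => x y x0 xy yT.
have fin a b : 0 <= a -> a <= b -> b <= T -> total_variation a b f \is a fin_num.
  move=> a0 ab bT; apply/bounded_variationP => //.
  apply: (bounded_variationl ab bT).
  exact: (bounded_variationr a0 (le_trans ab bT)).
rewrite (total_variationD f x0 xy) fineD; [|by rewrite fin// (le_trans xy)|exact: fin].
rewrite addrAC subrr add0r -lee_fin fineK; last exact: fin.
exact: total_variation_ge.
Qed.

Lemma controls_le (R : realType) (T : R) (v f : R -> R) x y :
  controls T v f -> 0 <= x -> x <= y -> y <= T -> v x <= v y.
Proof. by move=> c x0 xy yT; rewrite -subr_ge0 (le_trans _ (c x y x0 xy yT)). Qed.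

Lemma controls_bounded (R : realType) (T : R) (v f : R -> R) x :
  controls T v f -> 0 <= x <= T -> `|f x| <= `|f 0| + (v T - v 0).
Proof.
move=> c /andP[x0 xT]; rewrite -[f x](subrK (f 0)) addrC.
rewrite (le_trans (ler_normD _ _))// lerD2l (le_trans (c 0 x _ _ _))//.
by rewrite lerD2r (controls_le c).
Qed.

(** * Riemann-Stieltjes sums *)

Lemma compact_unif_cont (R : realType) (U : pseudoMetricType R)
    (V : normedModType R) (K : set U) (f : U -> V) :
  compact K -> {within K, continuous f} ->
  forall e : R, 0 < e -> exists2 d : R, 0 < d &
    forall x y, K x -> K y -> ball x d y -> `|f x - f y| < e.
Proof.
move=> cK /subspace_continuousP cf e e0.
move/compact_near_coveringP/near_covering_withinP : cK => cK.
have main : \forall d \near 0^'+,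
    K `<=` (fun x => forall y, K y -> ball x d y -> `|f x - f y| < e).
  apply: (cK R (0^'+)
    (fun d x => forall y, K y -> ball x d y -> `|f x - f y| < e)).
  move=> x Kx.
  have e20 : 0 < e / 2 by rewrite divr_gt0.
  have /cvgrPdist_lt /(_ _ e20) := cf _ Kx.
  rewrite near_withinE /= => /nbhs_ballP[r /= r0 fr].
  have r20 : 0 < r / 2 by rewrite divr_gt0.
  exists (ball x (r / 2), [set d | d < r / 2]) => /=.
    split; first exact: nbhsx_ballx.
    exact: nbhs_right_lt.
  move=> [x' d] /= [xx' dr] Kx' y Ky x'y.
  have h1 : `|f x - f x'| < e / 2.
    by apply: fr => //; apply: le_ball xx'; lra.
  have h2 : `|f x - f y| < e / 2.
    apply: fr => //; rewrite (_ : r = r / 2 + r / 2); last by field.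
    apply: (ball_triangle xx'); apply: le_ball x'y; exact: ltW.
  rewrite (_ : f x' - f y = (f x - f y) - (f x - f x')); last first.
    by rewrite opprB [RHS]addrC subrKA.
  rewrite (le_lt_trans (ler_normB _ _))// [ltRHS](splitr e) addrC.
  exact: ltrD.
near (0 : R)^'+ => d; exists d => // x y Kx Ky; move: y Ky.
exact: (near main d).
Unshelve. all: by end_near. Qed.

(** Summation by parts: the differences pass from [Y] to [a], so that only the
    size of [Y] and the variation of [a] matter. *)
Lemma abel_bound (R : realType) (V : normedModType R) (a : nat -> R)
    (Y : nat -> V) (m : nat) (w : R) :
  (forall j, (j < m)%N -> `|Y j.+1| <= w) ->
  a 0%N = 0 -> Y m = 0 ->
  `|\sum_(j < m) a j *: (Y j.+1 - Y j)| <= w * \sum_(j < m) `|a j.+1 - a j|.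
Proof.
move=> Yw a0 Ym.
have -> : \sum_(j < m) a j *: (Y j.+1 - Y j) =
    a m *: Y m - \sum_(j < m) (a j.+1 - a j) *: Y j.+1.
  elim: m {Yw Ym} => [|m ih]; first by rewrite !big_ord0 a0 scale0r subr0.
  have E (p q r s : V) : p - s + (q - p) = r - (s + (r - q)).
    by rewrite [LHS]addrC subrKA opprD opprB addrCA [r + _]addrC subrK addrC.
  by rewrite !big_ord_recr/= ih scalerBr scalerBl; exact: E.
rewrite Ym scaler0 sub0r normrN mulr_sumr.
rewrite (le_trans (ler_norm_sum _ _ _))// ler_sum// => j _.
by rewrite normrZ mulrC ler_wpM2r// Yw.
Qed.

Definition rs_sum (R : realType) (T : R) (V : normedModType R)
    (f : R -> R) (X : R -> V) (n : nat) : V :=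
  \sum_(k < n) f (grid T n k) *: (X (grid T n k.+1) - X (grid T n k)).

Lemma big_ord_mul (V : nmodType) n m (F : nat -> V) :
  \sum_(i < n * m) F i = \sum_(k < n) \sum_(j < m) F (k * m + j)%N.
Proof.
rewrite -(big_mkord xpredT F) big_nat_mul big_mkord; apply: eq_bigr => k _.
rewrite -[X in \sum_(X <= _ < _) _]add0n big_addn mulSn addnK big_mkord.
by apply: eq_bigr => j _; rewrite addnC.
Qed.

(** Inside one cell of the coarse grid the two sums differ by a sum to which
    [abel_bound] applies, with [X] recentred at the right end of the cell, where
    it varies by at most [w]. *)
Lemma rs_sum_refine (R : realType) (T : R) (V : normedModType R)
    (v f : R -> R) (X : R -> V) (n m : nat) (w : R) :
  0 <= T -> controls T v f -> (0 < n)%N -> (0 < m)%N ->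
  (forall x y, 0 <= x -> x <= y -> y <= T -> y - x <= T / n%:R ->
     `|X x - X y| <= w) ->
  `|rs_sum T f X n - rs_sum T f X (n * m)| <= w * (v T - v 0).
Proof.
move=> T0 cf n0 m0 Xw.
pose u i := grid T (n * m) i.
have nm0 : (0 < n * m)%N by rewrite muln_gt0 n0.
have uk k : u (k * m)%N = grid T n k by rewrite /u grid_mul.
have uT i : (i <= n * m)%N -> u i <= T by move=> ?; exact: grid_leT.
have u_ge0 i : 0 <= u i by exact: grid_ge0.
have ule i j : (i <= j)%N -> u i <= u j by move=> ?; exact: grid_le.
have km (k : 'I_n) j : (j <= m)%N -> (k * m + j <= n * m)%N.
  move=> jm; rewrite (@leq_trans (k.+1 * m)%N)//.
    by rewrite mulSn addnC leq_add2r.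
  by rewrite leq_mul2r ltn_ord orbT.
have -> : rs_sum T f X n - rs_sum T f X (n * m) =
  \sum_(k < n) \sum_(j < m) (f (u (k * m)%N) - f (u (k * m + j)%N)) *:
     ((X (u (k * m + j).+1) - X (u (k * m + m)%N))
       - (X (u (k * m + j)%N) - X (u (k * m + m)%N))).
  rewrite /rs_sum (big_ord_mul _ _
    (fun i => f (grid T (n * m) i) *: (X (grid T (n * m) i.+1) - X (grid T (n * m) i)))).
  rewrite -sumrB; apply: eq_bigr => k _.
  rewrite -/(u _) (_ : f (grid T n k) *: _ = \sum_(j < m) f (u (k * m)%N) *:
      (X (u (k * m + j).+1) - X (u (k * m + j)%N))).
    rewrite -sumrB; apply: eq_bigr => j _.
    by rewrite -scalerBl opprB addrA subrK.
  rewrite -scaler_sumr uk; congr (_ *: _).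
  rewrite -(uk k.+1) -(uk k).
  rewrite (_ : \sum_(j < m) _ = \sum_(0 <= j < m)
    (X (u (k * m + j.+1)%N) - X (u (k * m + j)%N))); last first.
    by rewrite big_mkord; apply: eq_bigr => j _; rewrite addnS.
  by rewrite (telescope_sumr (fun j => X (u (k * m + j)%N)))// addn0 mulSn addnC.
rewrite (le_trans (ler_norm_sum _ _ _))//.
have -> : v T - v 0 = \sum_(k < n) (v (u (k * m + m)%N) - v (u (k * m)%N)).
  rewrite (_ : \sum_(k < n) _ = \sum_(0 <= k < n) (v (u (k.+1 * m)%N) - v (u (k * m)%N))).
    rewrite (telescope_sumr (fun j => v (u (j * m)%N)))//.
    by rewrite !uk grid0 gridn.
  by rewrite big_mkord; apply: eq_bigr => k _; rewrite mulSn addnC.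
rewrite mulr_sumr ler_sum// => k _.
under eq_bigr do rewrite -addnS.
apply: (le_trans (@abel_bound _ _ (fun j => f (u (k * m)%N) - f (u (k * m + j)%N))
  (fun j => X (u (k * m + j)%N) - X (u (k * m + m)%N)) m w _ _ _)) => /=.
- move=> j jm; apply: Xw => //.
  + by apply: ule; rewrite leq_add2l.
  + exact/uT/km.
  + rewrite (le_trans (y := u (k.+1 * m)%N - u (k * m)%N))//.
      by rewrite mulSn [(m + _)%N]addnC lerB// ule// leq_addr.
    by rewrite !uk grid_step.
- by rewrite addn0 subrr.
- by rewrite subrr.
rewrite ler_wpM2l//.
  by rewrite (le_trans _ (Xw 0 0 _ _ _ _))// subrr divr_ge0.
have -> : v (u (k * m + m)%N) - v (u (k * m)%N) =
    \sum_(j < m) (v (u (k * m + j.+1)%N) - v (u (k * m + j)%N)).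
  rewrite -(big_mkord xpredT (fun j => v (u (k * m + j.+1)%N) - v (u (k * m + j)%N))).
  by rewrite (telescope_sumr (fun j => v (u (k * m + j)%N)))// addn0.
apply: ler_sum => j _; rewrite opprB [_ - _ + _]addrC subrKA distrC.
apply: cf => //; first by apply: ule; rewrite leq_add2l.
by apply: uT; apply: km.
Qed.

Lemma near_mesh (R : realType) (T d : R) : 0 < d ->
  \forall n \near \oo, (0 < n)%N /\ T / n%:R < d.
Proof.
move=> d0; near=> n.
have n0 : (0 < n)%N by near: n; exists 1%N.
split => //; rewrite ltr_pdivrMr ?ltr0n// mulrC -ltr_pdivrMr//.
by near: n; exact: nbhs_infty_gtr.
Unshelve. all: by end_near. Qed.

(** Two grids are compared with their common refinement, the grid with [n * m]
    cells. *)
Lemma rs_sum_cauchy (R : realType) (T : R) (V : completeNormedModType R)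
    (v f : R -> R) (X : R -> V) :
  0 <= T -> controls T v f -> {within `[0, T], continuous X} ->
  cvgn (rs_sum T f X).
Proof.
move=> T0 cf cX; apply/cauchy_cvgP/cauchy_exP => e e0.
have vT : 0 <= v T - v 0 by rewrite subr_ge0 (controls_le cf).
pose w := e / 2 / (v T - v 0 + 1).
have w0 : 0 < w by rewrite !divr_gt0//; lra.
have [d d0 Xd] := compact_unif_cont (@segment_compact _ 0 T) cX w0.
have we : w * (v T - v 0) < e / 2.
  rewrite /w -[ltRHS](@divfK _ (v T - v 0 + 1)); last by rewrite gt_eqF//; lra.
  by rewrite ltr_pM2l// ltrDl.
have mesh := near_mesh T d0.
have close n m : (0 < n)%N /\ T / n%:R < d -> (0 < m)%N ->
    `|rs_sum T f X n - rs_sum T f X (n * m)| < e / 2.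
  move=> [n0 nd] m0; apply: le_lt_trans we.
  apply: (rs_sum_refine T0 cf n0 m0) => x y x0 xy yT yx.
  apply/ltW/Xd; rewrite /= ?in_itv/=.
  - by rewrite x0 (le_trans xy).
  - by rewrite yT (le_trans x0).
  - by rewrite /ball/= distrC ger0_norm ?subr_ge0// (le_lt_trans yx).
near \oo => n; exists (rs_sum T f X n).
have hn : (0 < n)%N /\ T / n%:R < d by near: n.
suff : \forall m \near \oo, ball (rs_sum T f X n) e (rs_sum T f X m) by [].
near=> m.
have hm : (0 < m)%N /\ T / m%:R < d by near: m.
rewrite -ball_normE/= -(subrKA (rs_sum T f X (n * m))).
rewrite (le_lt_trans (ler_normD _ _))// [ltRHS](splitr e) ltrD ?close ?hm.1//.
by rewrite distrC mulnC close// hn.1.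
Unshelve. all: by end_near. Qed.

(** Unlike the trivial bound, this one does not grow with the number of cells:
    it lets [X] vary with [n] as long as it converges uniformly. *)
Lemma rs_sum_le (R : realType) (T : R) (V : normedModType R)
    (v f : R -> R) (X : R -> V) (n : nat) (w : R) :
  0 <= T -> controls T v f ->
  (forall x, 0 <= x <= T -> `|X x| <= w) ->
  `|rs_sum T f X n| <= 2 * w * (`|f 0| + (v T - v 0)).
Proof.
move=> T0 cf Xw.
have w0 : 0 <= w by rewrite (le_trans _ (Xw 0 _))// lexx.
have vT : 0 <= v T - v 0 by rewrite subr_ge0 (controls_le cf).
have [->|] := eqVneq n 0%N.
  by rewrite /rs_sum big_ord0 normr0 !mulr_ge0// addr_ge0.
rewrite -lt0n => n0.
have Xg j : (j <= n)%N -> `|X (grid T n j)| <= w.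
  by move=> jn; rewrite Xw// grid_ge0// grid_leT.
have -> : rs_sum T f X n = f 0 *: (X T - X 0) +
   \sum_(j < n) (f (grid T n j) - f 0) *:
     ((X (grid T n j.+1) - X T) - (X (grid T n j) - X T)).
  rewrite (_ : f 0 *: _ = \sum_(j < n) f 0 *:
      (X (grid T n j.+1) - X (grid T n j))); last first.
    rewrite -scaler_sumr; congr (_ *: _).
    rewrite -(big_mkord xpredT (fun j => X (grid T n j.+1) - X (grid T n j))).
    by rewrite (telescope_sumr (fun j => X (grid T n j)))// grid0 gridn.
  rewrite -big_split/=; apply: eq_bigr => j _.
  by rewrite opprB subrKA -scalerDl [f 0 + _]addrC subrK.
have X2 j : (j <= n)%N -> `|X (grid T n j) - X T| <= 2 * w.
  move=> jn; rewrite (le_trans (ler_normB _ _))// mulr_natl mulr2n lerD ?Xg//.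
  by rewrite Xw// T0 lexx.
rewrite (le_trans (ler_normD _ _))// mulrDr lerD//.
  rewrite normrZ mulrC ler_wpM2r// -[X in X - _](_ : X T - X 0 + X 0 = _) ?subrK//.
  by have := X2 0%N (leq0n n); rewrite grid0 distrC.
apply: (le_trans (@abel_bound _ _ (fun j => f (grid T n j) - f 0)
  (fun j => X (grid T n j) - X T) n (2 * w) _ _ _)) => /=.
- by move=> j jn; exact: X2.
- by rewrite grid0 subrr.
- by rewrite gridn// subrr.
rewrite ler_wpM2l ?mulr_ge0//.
have -> : v T - v 0 = \sum_(j < n) (v (grid T n j.+1) - v (grid T n j)).
  rewrite -(big_mkord xpredT (fun j => v (grid T n j.+1) - v (grid T n j))).
  by rewrite (telescope_sumr (fun j => v (grid T n j)))// grid0 gridn.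
apply: ler_sum => j _; rewrite opprB addrA subrK; apply: cf.
- exact: grid_ge0.
- exact: grid_le.
- exact: grid_leT.
Qed.

(** * Hilbert spaces and completions of the step functions *)

Section hilbert_theory.
Context (R : realType) (E : hilbert R).
Implicit Types x y z : E.

Lemma ipDl x y z : ip (x + y) z = ip x z + ip y z.
Proof. by rewrite -[x]scale1r ip_linear mul1r scale1r. Qed.

Lemma ip0l z : ip 0 z = 0.
Proof. by apply: (addrI (ip 0 z)); rewrite -ipDl !addr0. Qed.

Lemma ipZl c x z : ip (c *: x) z = c * ip x z.
Proof. by rewrite -[c *: x]addr0 ip_linear ip0l addr0. Qed.

Lemma ipDr x y z : ip z (x + y) = ip z x + ip z y.
Proof. by rewrite ipC ipDl ipC [ip y z]ipC. Qed.

Lemma ipZr c x z : ip z (c *: x) = c * ip z x.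
Proof. by rewrite ipC ipZl ipC. Qed.

Lemma ip_suml n (x : 'I_n -> E) z :
  ip (\sum_(i < n) x i) z = \sum_(i < n) ip (x i) z.
Proof.
by apply: (big_morph (fun x => ip x z)) => [u v|]; [exact: ipDl|exact: ip0l].
Qed.

Lemma ip_sumr n (x : 'I_n -> E) z :
  ip z (\sum_(i < n) x i) = \sum_(i < n) ip z (x i).
Proof. by rewrite ipC ip_suml; apply: eq_bigr => i _; rewrite ipC. Qed.

Lemma ip_polar x y : ip x y = 4^-1 * (`|x + y| ^+ 2 - `|x - y| ^+ 2).
Proof.
by rewrite -!ip_norm -[- y]scaleN1r !(ipDl, ipDr, ipZl, ipZr) (ipC y x); field.
Qed.

(** By polarization, the continuity of the inner product is that of the norm. *)
Lemma cvg_ip (x_ y_ : nat -> E) x y :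
  x_ @ \oo --> x -> y_ @ \oo --> y ->
  (fun n => ip (x_ n) (y_ n)) @ \oo --> ip x y.
Proof.
move=> hx hy; rewrite ip_polar; under eq_fun do rewrite ip_polar.
apply: cvgMl_tmp; apply: cvgB; rewrite /GRing.exp/=; apply: cvgM; apply: cvg_norm;
  solve [exact: cvgD|exact: cvgB].
Qed.

End hilbert_theory.

(** The covariance of the increments over [[a, b]] and [[c, e]] of a process with
    covariance [K]. *)
Definition rect (R : realType) (K : R -> R -> R) (a b c e : R) : R :=
  K b e - K b c - K a e + K a c.

Section step_completion_theory.
Context (R : realType) (T : R) (q : R -> R -> R -> R -> R) (K : R -> R -> R).
Hypothesis T0 : 0 <= T.
Hypothesis qK : forall a b c e, 0 <= a -> a <= b -> b <= T ->
  0 <= c -> c <= e -> e <= T -> q a b c e = rect K a b c e.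
Hypothesis cK : continuous_cov K.
Context (E : step_completion T q).

Let X (t : R) : E := sc_class E \1_(`[0, t[%classic).

Let step1 a b : 0 <= a -> a <= b -> b <= T ->
  step_fun T (\1_(`[a, b[%classic) : R -> R).
Proof.
move=> a0 ab bT; exists 1%N, (fun=> 1), (fun=> a), (fun=> b); split=> //.
by apply/funext => x; rewrite big_ord1 mul1r.
Qed.

Let step0 : step_fun T (fun=> 0 : R).
Proof.
exists 0%N, (fun=> 0), (fun=> 0), (fun=> 0); split=> [[]//|].
by apply/funext => x; rewrite big_ord0.
Qed.

Let sc0 : sc_class E (fun=> 0) = 0.
Proof.
have := sc_linear E 1 step0 step0.
rewrite (_ : (fun x => _) = (fun=> 0)); last by apply/funext => x; rewrite mulr0 addr0.
by rewrite scale1r -{1}[sc_class E _]addr0 => /addrI.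
Qed.

Let sc_itv a b : 0 <= a -> a <= b -> b <= T ->
  sc_class E \1_(`[a, b[%classic) = X b - X a.
Proof.
move=> a0 ab bT.
have -> : \1_(`[a, b[%classic) =
    (fun x => -1 * \1_(`[0, a[%classic) x + \1_(`[0, b[%classic) x) :> (R -> R).
  apply/funext => x; rewrite !indicE !mem_setE/= !in_itv/=.
  case: (leP a x) => ax /=.
    by rewrite (le_trans a0 ax)/= mulr0 add0r.
  rewrite (lt_le_trans ax ab) !andbT; case: (0 <= x) => /=.
    by rewrite mulr1 addNr.
  by rewrite mulr0 addr0.
rewrite sc_linear; first by rewrite scaleN1r addrC.
  by apply: step1 => //; exact: le_trans bT.
by apply: step1 => //; exact: le_trans ab.
Qed.

Let ip_itv a b c e : 0 <= a -> a <= b -> b <= T -> 0 <= c -> c <= e -> e <= T ->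
  ip (X b - X a) (X e - X c) = rect K a b c e.
Proof. by move=> *; rewrite -!sc_itv// sc_ip// qK. Qed.

(** The squared distance between two points of the curve is an increment of [K]
    over a square that shrinks to a point. *)
Lemma sc_curve_continuous : {within `[0, T], continuous X}.
Proof.
apply/subspace_continuousP => s /=; rewrite in_itv/= => /andP[s0 sT].
have hK : (fun t => rect K s t s t) t @[t --> within `[0, T] (nbhs s)] --> rect K s s s s.
  have K2 (u v : R -> R) : u t @[t --> within `[0, T] (nbhs s)] --> u s ->
      v t @[t --> within `[0, T] (nbhs s)] --> v s -> (forall t, t \in `[0, T] -> 0 <= u t /\ 0 <= v t) ->
      K (u t) (v t) @[t --> within `[0, T] (nbhs s)] --> K (u s) (v s).
    move=> cu cv uv.
    move/subspace_continuousP : cK => /(_ (u s, v s)) /= /(_ (uv s _)).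
    rewrite in_itv/= s0 sT => /(_ isT) cKs.
    apply: (@cvg_comp _ _ _ (fun t => (u t, v t)) (fun z => K z.1 z.2) _ _ _ _ cKs).
    move=> A hA.
    have hF : Filter (within `[0, T]%classic (nbhs s)) by exact: within_filter.
    have hc := cvg_pair cu cv.
    have h2 : within `[0, T]%classic (nbhs s)
        (fun t => 0 <= u t /\ 0 <= v t -> A (u t, v t)).
      exact: (hc hF _ _ _ hA).
    have h1 := withinT `[0, T]%classic (nbhs_filter s).
    by apply: filterS2 h1 h2 => t tT; apply; exact: uv.
  have ci : id t @[t --> within `[0, T] (nbhs s)] --> id s.
    by apply: cvg_within.
  have cs : (fun=> s) t @[t --> within `[0, T] (nbhs s)] --> (fun=> s) s.
    exact: cvg_cst.
  have h t : t \in `[0, T] -> 0 <= t by rewrite in_itv/= => /andP[].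
  apply: cvgD; last exact: cvg_cst.
  apply: cvgB; [apply: cvgB|].
  - by apply: K2 => // t /h.
  - by apply: K2 => // t /h.
  - by apply: (K2 (fun=> s) id) => // t /h.
have hN : (fun t => `|X s - X t| ^+ 2) t @[t --> within `[0, T] (nbhs s)] --> 0.
  have E0 : rect K s s s s = 0 by rewrite /rect; ring.
  rewrite E0 in hK; apply: cvg_trans hK; apply: near_eq_cvg.
  apply: filterS (withinT `[0, T]%classic (nbhs_filter s)) => t /=.
  rewrite in_itv/= => /andP[t0 tT]; rewrite -ip_norm.
  have [st|/ltW ts] := leP s t.
    by rewrite -[X s - X t]opprB -scaleN1r ipZl ipZr ip_itv//; ring.
  by rewrite ip_itv// /rect; ring.
apply/cvgrPdist_lt => e e0.
have e2 : 0 < e ^+ 2 by rewrite exprn_gt0.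
move/cvgrPdist_lt : hN => /(_ _ e2); apply: filterS => t.
rewrite sub0r normrN normrX normr_id ltr_pXn2r ?nnegrE//; exact: ltW.
Qed.

Lemma sc_class_step_approx f n :
  sc_class E (step_approx T f n) = rs_sum T f X n.
Proof.
have step m : (m <= n)%N -> step_fun T (fun x =>
     \sum_(k < m) f (grid T n k) * \1_(`[grid T n k, grid T n k.+1[%classic) x).
  move=> mn; exists m, (fun k => f (grid T n k)), (fun k => grid T n k),
    (fun k => grid T n k.+1); split=> // i; split.
  - exact: grid_ge0.
  - exact: grid_le.
  - by apply: grid_leT => //; exact: leq_trans mn.
suff main m : (m <= n)%N -> sc_class E (fun x => \sum_(k < m)
       f (grid T n k) * \1_(`[grid T n k, grid T n k.+1[%classic) x) =
     \sum_(k < m) f (grid T n k) *: (X (grid T n k.+1) - X (grid T n k)).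
  exact: main (leqnn n).
elim: m => [|m ih] mn.
  rewrite big_ord0 -sc0; congr (sc_class _ _).
  by apply/funext => x; rewrite big_ord0.
rewrite big_ord_recr/= -ih ?(ltnW mn)// -sc_itv; last first.
- exact: grid_leT.
- exact: grid_le.
- exact: grid_ge0.
rewrite addrC -sc_linear.
- by congr (sc_class _ _); apply/funext => x; rewrite big_ord_recr/= addrC.
- by apply: step1; [exact: grid_ge0|exact: grid_le|exact: grid_leT].
- by apply: step; exact: ltnW.
Qed.

Lemma bv_class_cvg f : bounded_variation 0 T f ->
  sc_class E (step_approx T f n) @[n --> \oo] --> bv_class E f.
Proof.
move=> /(bounded_variation_controls T0)[v cf]; rewrite /bv_class.
have -> : (fun n => sc_class E (step_approx T f n)) = rs_sum T f X.
  by apply/funext => n; exact: sc_class_step_approx.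
exact: (rs_sum_cauchy T0 cf sc_curve_continuous).
Qed.

Lemma ip_step_approx f g n :
  ip (sc_class E (step_approx T f n)) (sc_class E (step_approx T g n)) =
  \sum_(a < n) \sum_(c < n) f (grid T n a) * g (grid T n c) *
    rect K (grid T n a) (grid T n a.+1) (grid T n c) (grid T n c.+1).
Proof.
rewrite !sc_class_step_approx /rs_sum ip_suml; apply: eq_bigr => a _.
rewrite ip_sumr; apply: eq_bigr => c _.
rewrite ipZl ipZr mulrA ip_itv//; by [exact: grid_ge0|exact: grid_le|exact: grid_leT].
Qed.

End step_completion_theory.

(** * Powers of the absolute value and mean value inequalities *)

Section absolute_power.
Context (R : realType) (p : R).
Hypothesis p0 : 0 < p.

(** As [x `^ p] is 1 for negative [x], the absolute value is needed to obtain a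
    function that is continuous on the whole line. *)
Definition absp (x : R) : R := `|x| `^ p.
Definition dabsp (x : R) : R := p * Num.sg x * `|x| `^ (p - 1).

Lemma is_derive_absp (x : R) : x != 0 -> is_derive x 1 absp (dabsp x).
Proof.
move=> x0; have [xgt|xlt] : 0 < x \/ x < 0 by case: ltgtP x0 => //; auto.
- rewrite /dabsp gtr0_sg// mulr1 gtr0_norm//.
  apply: (@near_eq_is_derive _ _ _ (fun y => y `^ p)).
  by near=> y; rewrite /absp gtr0_norm//; near: y; exact: lt_nbhsr.
  exact: is_derive1_powR.
- rewrite /dabsp. rewrite ltr0_sg// mulrN1 ltr0_norm//.
  apply: (@near_eq_is_derive _ _ _ ((fun y => y `^ p) \o -%R)).
    by near=> y; rewrite /absp/= ltr0_norm//; near: y; exact: lt_nbhsl.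
  have Nx : 0 < - x by rewrite oppr_gt0.
  have -> : - p * (- x) `^ (p - 1) = p * (- x) `^ (p - 1) * -1 by ring.
  have d1 : is_derive x 1 (-%R : R -> R) (-1).
    by apply: is_derive_eq.
  have d2 : is_derive (- x) 1 ((@powR R)^~ p) (p * (- x) `^ (p - 1)).
    exact: is_derive1_powR.
  exact: (@is_derive1_comp _ _ _ _ _ _ d2 d1).
Unshelve. all: by end_near. Qed.

Lemma absp0 : absp 0 = 0.
Proof. by rewrite /absp normr0 powR0// gt_eqF. Qed.

Lemma continuous_absp : continuous absp.
Proof.
move=> x; have [->|x0] := eqVneq x 0; last first.
  apply: differentiable_continuous; apply/derivable1_diffP.
  by have [] := is_derive_absp x0.
apply/cvgrPdist_lt => e e0; rewrite absp0.
have /cvgrPdist_lt /(_ _ e0) := powR_cvg0 p0.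
rewrite near_withinE /= => /nbhs_ballP[d /= d0 dP].
apply/nbhs_ballP; exists d => // y; rewrite /ball/= sub0r normrN => yd.
have [->|y0] := eqVneq y 0; first by rewrite absp0 subrr normr0.
apply: dP; last by rewrite normr_gt0.
by rewrite /ball/= sub0r normrN normr_id.
Qed.

End absolute_power.

Section mean_value.
Context (R : realType).
Implicit Types (F G dF dG : R -> R) (a b : R).

Lemma mean_value_bound F G dF dG a b : a <= b ->
  (forall x, a < x < b -> is_derive x 1 F (dF x)) ->
  (forall x, a < x < b -> is_derive x 1 G (dG x)) ->
  (forall x, a < x < b -> `|dF x| <= dG x) ->
  {within `[a, b], continuous F} -> {within `[a, b], continuous G} ->
  `|F b - F a| <= G b - G a.
Proof.
rewrite le_eqVlt => /predU1P[->|ab] hF hG FG cF cG.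
  by rewrite !subrr normr0.
have cGF : {within `[a, b], continuous (G - F)}.
  by move=> x; apply: cvgB; [exact: cG|exact: cF].
have cGD : {within `[a, b], continuous (G + F)}.
  by move=> x; apply: cvgD; [exact: cG|exact: cF].
have dGF x : x \in `]a, b[ -> is_derive x 1 (G - F) (dG x - dF x).
  by rewrite in_itv => xab; apply: is_deriveB; [exact: hG|exact: hF].
have dGD x : x \in `]a, b[ -> is_derive x 1 (G + F) (dG x + dF x).
  by rewrite in_itv => xab; apply: is_deriveD; [exact: hG|exact: hF].
have [x xab h] := MVT ab dGF cGF.
have [y yab h'] := MVT ab dGD cGD.
move: xab yab; rewrite !in_itv => /FG; rewrite ler_norml => /andP[_ x2].
move=> /FG; rewrite ler_norml => /andP[y1 _].
have {}h : 0 <= (G - F) b - (G - F) a.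
  by rewrite h mulr_ge0// ?subr_ge0// ltW.
have {}h' : 0 <= (G + F) b - (G + F) a.
  rewrite h' mulr_ge0 ?subr_ge0//; last exact: ltW.
  by rewrite addrC -lerBlDr sub0r.
move: h h'; rewrite !fctE ler_norml; lra.
Qed.

(** The interval is cut at the exceptional points. They are needed because the
    hypothesis on a covariance says nothing of its derivative in [t] on the
    diagonal [t = s]. *)
Lemma mean_value_bound_except (S : seq R) F G dF dG a b : a <= b ->
  (forall x, a < x < b -> x \notin S -> is_derive x 1 F (dF x)) ->
  (forall x, a < x < b -> x \notin S -> is_derive x 1 G (dG x)) ->
  (forall x, a < x < b -> x \notin S -> `|dF x| <= dG x) ->
  {within `[a, b], continuous F} -> {within `[a, b], continuous G} ->
  `|F b - F a| <= G b - G a.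
Proof.
elim: S a b => [|s S ih] a b ab hF hG FG cF cG.
  by apply: (mean_value_bound (dF := dF) (dG := dG)) => // x xab;
    [exact: hF|exact: hG|exact: FG].
have [sab|nsab] := boolP (a < s < b); last first.
  by apply: ih => // x xab xS; [apply: hF|apply: hG|apply: FG] => //;
    rewrite in_cons negb_or xS andbT; apply: contraNneq nsab => <-.
have /andP[/ltW as_ /ltW sb] := sab.
have -> : F b - F a = (F s - F a) + (F b - F s) by ring.
have -> : G b - G a = (G s - G a) + (G b - G s) by ring.
rewrite (le_trans (ler_normD _ _))// lerD//.
- have sub x : a < x < s -> a < x < b /\ x != s.
    by move=> /andP[-> xs]; rewrite (lt_le_trans xs)// lt_eqF.
  apply: ih => //.
  + by move=> x /sub[? ?] ?; apply: hF => //; rewrite in_cons negb_or; apply/andP.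
  + by move=> x /sub[? ?] ?; apply: hG => //; rewrite in_cons negb_or; apply/andP.
  + by move=> x /sub[? ?] ?; apply: FG => //; rewrite in_cons negb_or; apply/andP.
  + by apply: continuous_subspaceW cF; apply: subset_itvl; rewrite bnd_simp.
  + by apply: continuous_subspaceW cG; apply: subset_itvl; rewrite bnd_simp.
- have sub x : s < x < b -> a < x < b /\ x != s.
    by move=> /andP[xs ->]; rewrite (le_lt_trans _ xs)// gt_eqF.
  apply: ih => //.
  + by move=> x /sub[? ?] ?; apply: hF => //; rewrite in_cons negb_or; apply/andP.
  + by move=> x /sub[? ?] ?; apply: hG => //; rewrite in_cons negb_or; apply/andP.
  + by move=> x /sub[? ?] ?; apply: FG => //; rewrite in_cons negb_or; apply/andP.
  + by apply: continuous_subspaceW cF; apply: subset_itvr; rewrite bnd_simp.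
  + by apply: continuous_subspaceW cG; apply: subset_itvr; rewrite bnd_simp.
Qed.

End mean_value.

(** The [mu]-mass of [[a, b]]. *)
Definition mass (R : realType) (H a b : R) : R := (b `^ H - a `^ H) / H.

Lemma mass_ge0 (R : realType) (H a b : R) : 0 < H -> 0 <= a -> a <= b ->
  0 <= mass H a b.
Proof.
move=> H0 a0 ab; rewrite /mass divr_ge0 ?(ltW H0)// subr_ge0.
by rewrite ge0_ler_powR ?nnegrE ?(ltW H0)// (le_trans a0).
Qed.

(** * The covariance of fractional Brownian motion *)

Section RB_theory.
Context (R : realType) (H : R).
Hypothesis H0 : 0 < H.

Let p := 2 * H.
Let p0 : 0 < p. Proof. by rewrite /p mulr_gt0. Qed.

Definition dRBf (t s : R) : R := 2^-1 * (dabsp p t - dabsp p (t - s)).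

Lemma RB_absp (t s : R) : 0 <= t -> 0 <= s ->
  RB H t s = 2^-1 * (absp p t + absp p s - absp p (t - s)).
Proof. by move=> t0 s0; rewrite /RB /absp (ger0_norm t0) (ger0_norm s0). Qed.

Lemma is_derive_RB (t s : R) : 0 < t -> 0 <= s -> t != s ->
  is_derive t 1 (RB H ^~ s) (dRBf t s).
Proof.
move=> t0 s0 ts.
apply: (@near_eq_is_derive _ _ _
  (fun t => 2^-1 *: (absp p t + absp p s - (absp p \o (fun t => t - s)) t))).
  near=> u; rewrite RB_absp//.
  by apply: ltW; near: u; exact: lt_nbhsr.
have d1 : is_derive t 1 (absp p) (dabsp p t).
  by apply: is_derive_absp; rewrite // gt_eqF.
have d2 : is_derive t 1 (absp p \o (fun t => t - s)) (dabsp p (t - s)).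
  have d3 : is_derive (t - s) 1 (absp p) (dabsp p (t - s)).
    by apply: is_derive_absp; rewrite // subr_eq0.
  have d4 : is_derive t 1 (fun t => t - s) 1.
    by apply: is_derive_eq; rewrite subr0.
  by have := @is_derive1_comp _ (absp p) (fun t => t - s) t _ _ d3 d4; rewrite mulr1.
rewrite /dRBf; apply: is_deriveZ.
by apply: is_derive_eq; rewrite addr0.
Unshelve. all: by end_near. Qed.

Lemma dRBE (t s : R) : 0 < t -> 0 <= s -> t != s -> dRB H t s = dRBf t s.
Proof.
move=> t0 s0 ts; rewrite /dRB derive1E.
by have [_ ->] := is_derive_RB t0 s0 ts.
Qed.

Lemma continuous_cov_RB : continuous_cov (RB H).
Proof.
apply: (@subspace_eq_continuous _ _ _ (fun z : R * R =>
   2^-1 * (absp p z.1 + absp p z.2 - absp p (z.1 - z.2)))).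
  by move=> [t s]; rewrite inE/= => -[t0 s0]; rewrite -RB_absp.
apply: continuous_subspaceT => z.
have c1 : {for z, continuous (fun z : R * R => z.1)} by exact: cvg_fst.
have c2 : {for z, continuous (fun z : R * R => z.2)} by exact: cvg_snd.
have ca x := @continuous_absp _ _ p0 x.
have c3 : absp p z'.1 @[z' --> z] --> absp p z.1.
  exact: (cvg_comp fst (absp p) c1 (ca _)).
have c4 : absp p z'.2 @[z' --> z] --> absp p z.2.
  exact: (cvg_comp snd (absp p) c2 (ca _)).
have c12 : z'.1 - z'.2 @[z' --> z] --> z.1 - z.2 by exact: cvgB.
have c5 : absp p (z'.1 - z'.2) @[z' --> z] --> absp p (z.1 - z.2).
  exact: (cvg_comp (fun z' => z'.1 - z'.2) (absp p) c12 (ca _)).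
by apply: cvgMl_tmp; apply: cvgB => //; exact: cvgD.
Qed.

End RB_theory.

(** * Increments of the difference of the covariances *)

Lemma continuous_cov_slice (R : realType) (K : R -> R -> R) (a b s : R) :
  continuous_cov K -> 0 <= a -> 0 <= s ->
  {within `[a, b], continuous (K ^~ s)}.
Proof.
move=> /subspace_continuousP cK a0 s0; apply/subspace_continuousP => t /=.
rewrite in_itv/= => /andP[at_ tb].
have {}cK := cK (t, s) (conj (le_trans a0 at_) s0).
apply/cvgrPdist_lt => e e0.
move/cvgrPdist_lt : cK => /(_ _ e0) /=.
rewrite near_withinE /= => /nbhs_ballP[d /= d0 dP].
rewrite near_withinE /=; apply/nbhs_ballP; exists d => //= u tu.
rewrite in_itv/= => /andP[au ub]; apply: (dP (u, s)).
  by split => //=; exact: ballxx.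
by split => //=; exact: le_trans au.
Qed.

Section rectangle_bound.
Context (R : realType) (K : R -> R -> R) (H T C : R).
Hypotheses (H0 : 0 < H) (cK : continuous_cov K) (hA : hypA K H T C).

Let slope_bound (D : R -> R) t c e : 0 < t < T -> 0 <= c -> c <= e -> e <= T ->
  {within `[0, T], continuous D} ->
  (forall s, 0 < s < T ->
     derivable D s 1 /\ `|derive1 D s| <= C * `|t * s| `^ (H - 1)) ->
  `|D e - D c| <= C * t `^ (H - 1) * mass H c e.
Proof.
move=> /andP[t0 tT] c0 ce eT cD dD.
pose k := C * t `^ (H - 1) / H.
pose G s := k *: absp H s.
have -> : C * t `^ (H - 1) * mass H c e = G e - G c.
  rewrite /mass /G /k /absp !ger0_norm ?(le_trans c0)//; rewrite /GRing.scale/=.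
  by field; rewrite gt_eqF.
have in0T s : c < s < e -> 0 < s < T.
  by move=> /andP[cs se]; rewrite (le_lt_trans c0)//= (lt_le_trans se).
apply: (@mean_value_bound _ D G (derive1 D) (fun s => k *: dabsp H s) c e ce).
- move=> s /in0T /dD[ds _]; rewrite derive1E; exact: derivableP.
- move=> s /in0T /andP[s0 _]; apply: is_deriveZ.
  by apply: is_derive_absp; rewrite // gt_eqF.
- move=> s /in0T sT; have /andP[s0 _] := sT.
  have [_ /le_trans->//] := dD _ sT.
  rewrite gtr0_norm ?mulr_gt0// powRM ?(ltW s0) ?(ltW t0)// /k /dabsp.
  rewrite gtr0_sg// mulr1 gtr0_norm// /GRing.scale/= le_eqVlt; apply/orP; left.
  by apply/eqP; field; rewrite gt_eqF.
- apply: continuous_subspaceW cD => x /=; rewrite !in_itv/= => /andP[cx xe].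
  by rewrite (le_trans c0 cx) (le_trans xe).
- apply: continuous_subspaceT => x; apply: cvgZl_tmp; exact: continuous_absp.
Qed.

(** The mixed second derivative of the difference is dominated by the product of
    the densities of [mu]. It is integrated first in the second variable
    (that is [slope_bound]), then in the first one, both times in the form of a
    mean value inequality against the primitive of the density. *)
Lemma rect_bound a b c e : 0 <= a -> a <= b -> b <= T ->
  0 <= c -> c <= e -> e <= T ->
  `|rect K a b c e - rect (RB H) a b c e| <= C * (mass H a b * mass H c e).
Proof.
move=> a0 ab bT c0 ce eT.
have e0 : 0 <= e by exact: le_trans ce.
have cT : c <= T by exact: le_trans eT.
pose F t := (K t e - RB H t e) - (K t c - RB H t c).
pose dK s t := derive1 (K ^~ s) t.
pose dF t := (dK e t - dRB H t e) - (dK c t - dRB H t c).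
pose k := C * mass H c e / H.
have -> : rect K a b c e - rect (RB H) a b c e = F b - F a by rewrite /rect /F; ring.
pose G s := k *: absp H s.
have -> : C * (mass H a b * mass H c e) = G b - G a.
  rewrite {1}/mass /G /k /absp !ger0_norm ?(le_trans a0)//; rewrite /GRing.scale/=.
  by field; rewrite gt_eqF.
have in0T s : a < s < b -> 0 < s < T.
  by move=> /andP[cs se]; rewrite (le_lt_trans a0)//= (lt_le_trans se).
apply: (@mean_value_bound_except _ [:: c; e] F G dF (fun s => k *: dabsp H s) a b ab).
- move=> t /in0T tT; rewrite !inE negb_or => /andP[tc te].
  have /andP[t0 _] := tT.
  have [D [_ hD _]] := hypA_diff hA tT.
  have dd s : 0 <= s <= T -> t != s ->
      is_derive t 1 (fun t => K t s - RB H t s) (dK s t - dRB H t s).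
    move=> sT ts; have st : s != t by rewrite eq_sym.
    have [dKs _] := hD s sT st.
    have /andP[s0 _] := sT.
    apply: is_deriveB; first by rewrite /dK derive1E; exact: derivableP.
    by rewrite dRBE//; exact: is_derive_RB.
  by apply: is_deriveB; apply: dd; rewrite ?e0 ?c0 ?eT ?cT.
- move=> s /in0T /andP[s0 _] _; apply: is_deriveZ.
  by apply: is_derive_absp; rewrite // gt_eqF.
- move=> t /in0T tT; rewrite !inE negb_or => /andP[tc te].
  have /andP[t0 _] := tT.
  have [D [cD hD dD]] := hypA_diff hA tT.
  have -> : dF t = D e - D c.
    have eT' : 0 <= e <= T by rewrite e0.
    have cT' : 0 <= c <= T by rewrite c0.
    rewrite eq_sym in te; rewrite eq_sym in tc.
    by have [_ ->] := hD e eT' te; have [_ ->] := hD c cT' tc.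
  rewrite (le_trans (slope_bound tT c0 ce eT cD dD))// /k /dabsp.
  rewrite gtr0_sg// mulr1 gtr0_norm// /GRing.scale/= le_eqVlt; apply/orP; left.
  by apply/eqP; field; rewrite gt_eqF.
- have cRB := continuous_cov_RB H0.
  have cont s : 0 <= s -> {within `[a, b], continuous (fun t => K t s - RB H t s)}.
    move=> s0 x; apply: cvgB; first exact: (continuous_cov_slice cK a0 s0).
    exact: (continuous_cov_slice cRB a0 s0).
  by move=> x; apply: cvgB; exact: cont.
- apply: continuous_subspaceT => x; apply: cvgZl_tmp; exact: continuous_absp.
Qed.

End rectangle_bound.

(** * Second moments of Gaussian variables *)

Section gaussian_moment.
Context (R : realType).
Implicit Types m s : R.

Lemma normal_prob_integral_sqr_lty m s : s != 0 ->
  (\int[normal_prob m s]_x (x ^+ 2)%:E < +oo)%E.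
Proof.
move=> s0; pose mu := @lebesgue_measure R.
have dom : normal_prob m s `<< mu := normal_prob_dominates m s.
have msq : measurable_fun [set: R] (EFin \o (fun x : R => x ^+ 2)).
  by apply/measurable_EFinP; exact: exprn_measurable.
rewrite -(Radon_Nikodym_SigmaFinite.change_of_variables dom)//; last first.
  by move=> x; rewrite lee_fin sqr_ge0.
have mpdf m' s' : measurable_fun [set: R] (EFin \o normal_pdf m' s').
  by apply/measurable_EFinP; exact: measurable_normal_pdf.
rewrite (@ae_eq_integral _ _ _ mu setT (fun x => ((x ^+ 2)%:E * (normal_pdf m s x)%:E)%E))//; last 3 first.
- apply: emeasurable_funM => //.
  exact: measurable_int (Radon_Nikodym_SigmaFinite.f_integrable _).
- apply: emeasurable_funM; [exact: msq|exact: mpdf].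
- apply: ae_eqe_mul2l; apply: integral_ae_eq => //.
  + exact: Radon_Nikodym_SigmaFinite.f_integrable.
  + exact: mpdf.
  + by move=> A AT mA; rewrite -Radon_Nikodym_SigmaFinite.f_integral.
(* The Gaussian factor of variance [s ^+ 2] is the square of the one of variance
   [2 * s ^+ 2]: one of the two copies absorbs the polynomial factor, and the
   other one is integrable. *)
pose t := Num.sqrt 2 * s.
have t2 : t ^+ 2 = 2 * s ^+ 2 by rewrite /t exprMn sqr_sqrtr.
have t0 : t != 0 by rewrite mulf_neq0// gt_eqF// sqrtr_gt0.
have s2 : 0 < s ^+ 2 by rewrite exprn_even_gt0.
pose k := 8 * s ^+ 2 * normal_peak s / normal_peak t.
have k0 : 0 <= k by rewrite /k divr_ge0 ?normal_peak_ge0// mulr_ge0 ?normal_peak_ge0// mulr_ge0// sqr_ge0.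
pose g x : \bar R := (k%:E * (normal_pdf m t x)%:E + (2 * m ^+ 2)%:E * (normal_pdf m s x)%:E)%E.
have ig : mu.-integrable setT g.
  by apply: integrableD => //; apply: integrableZl => //; exact: integrable_normal_pdf.
apply: (@le_lt_trans _ _ (\int[mu]_x g x)%E); last first.
  have [_] := integrableP _ _ _ ig; apply: le_lt_trans.
  apply: ge0_le_integral => //.
  - move=> x _; rewrite /g -!EFinM -EFinD lee_fin addr_ge0// mulr_ge0 ?normal_pdf_ge0//.
    by rewrite mulr_ge0// sqr_ge0.
  - exact: measurable_int ig.
  - by apply: measurableT_comp => //; exact: measurable_int ig.
  - by move=> x _; exact: lee_abs.
apply: ge0_le_integral => //.
- by move=> x _; rewrite -EFinM lee_fin mulr_ge0 ?sqr_ge0 ?normal_pdf_ge0.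
- apply: emeasurable_funM; [exact: msq|exact: mpdf].
- exact: measurable_int ig.
move=> x _; rewrite /g -!EFinM -EFinD lee_fin !normal_pdfE//.
have -> : k * (normal_peak t * normal_fun m t x) =
    8 * s ^+ 2 * normal_peak s * normal_fun m t x.
  by rewrite /k; field; rewrite gt_eqF// normal_peak_gt0.
have h1 : x ^+ 2 <= 2 * (x - m) ^+ 2 + 2 * m ^+ 2.
  have : 0 <= (x - 2 * m) ^+ 2 by exact: sqr_ge0.
  by nra.
have h2 : (x - m) ^+ 2 * normal_fun m s x <= 4 * s ^+ 2 * normal_fun m t x.
  pose u := (x - m) ^+ 2 / (4 * s ^+ 2).
  have -> : (x - m) ^+ 2 = 4 * s ^+ 2 * u by rewrite /u; field.
  have -> : normal_fun m s x = expR (- u) * expR (- u).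
    by rewrite -expRD /normal_fun; congr expR; rewrite /u; field.
  have -> : normal_fun m t x = expR (- u).
    by rewrite /normal_fun t2; congr expR; rewrite /u; field.
  rewrite -[4 * s ^+ 2 * u * _]mulrA; apply: ler_wpM2l.
    by rewrite mulr_ge0// sqr_ge0.
  rewrite mulrA -[leRHS]mul1r ler_wpM2r ?expR_ge0// expRN ler_pdivrMr ?expR_gt0//.
  by rewrite mul1r (le_trans _ (expR_ge1Dx u))// lerDr.
have n0 := normal_peak_ge0 s; have f0 := normal_fun_ge0 m s x.
apply: (@le_trans _ _ ((2 * (x - m) ^+ 2 + 2 * m ^+ 2) * (normal_peak s * normal_fun m s x))).
  by rewrite ler_wpM2r// mulr_ge0.
have := ler_wpM2l n0 h2; nra.
Qed.

Lemma gaussian_rv_integrable_sqr d (Omega : measurableType d)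
    (P : probability Omega R) (X : {RV P >-> R}) :
  gaussian_rv P X -> P.-integrable setT (EFin \o (fun w => X w ^+ 2)).
Proof.
move=> [m [s hX]].
have msq : measurable_fun [set: R] (EFin \o (fun x : R => x ^+ 2)).
  by apply/measurable_EFinP; exact: exprn_measurable.
have sq0 (x : R) : (0 <= (x ^+ 2)%:E)%E by rewrite lee_fin sqr_ge0.
apply/integrableP; split.
  by apply/measurable_EFinP; apply: measurable_funX; exact: measurable_funPT.
under eq_integral do rewrite /= ger0_norm ?sqr_ge0//.
(* X is seen as a map into the type whose sigma-algebra carries normal_prob, so
   that its law can be compared with it. *)
pose X' : Omega -> measurableTypeR R := X.
have mX' : measurable_fun setT X' by exact: (measurable_funPT X).
have msq' : measurable_fun [set: measurableTypeR R]
  (EFin \o (fun x : R => x ^+ 2)) by exact: msq.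
have -> : (\int[P]_w (X w ^+ 2)%:E =
   \int[P]_(w in X' @^-1` setT) ((EFin \o (fun x : R => (x ^+ 2)%R)) \o X') w)%E.
  by rewrite preimage_setT.
rewrite -(@ge0_integral_pushforward _ _ _ _ _ X' mX' P setT _ measurableT msq'); last first.
  by move=> y _; exact: sq0.
move: hX; rewrite /gaussian_law; have [_|s0] := eqVneq s 0 => hX.
  rewrite (@eq_measure_integral _ _ _ _ (\d_(m : measurableTypeR R))); last first.
    by move=> A mA _; exact: hX.
  by rewrite integral_dirac// diracT mul1e ltry.
rewrite (@eq_measure_integral _ _ _ _ (normal_prob m s)); last first.
  by move=> A mA _; exact: hX.
exact: normal_prob_integral_sqr_lty.
Qed.

End gaussian_moment.

(** Square integrability makes all the products integrable, so that the
    expectation can be expanded. *)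
Lemma incr_covE (R : realType) d (Omega : measurableType d)
    (P : probability Omega R) (G : R -> {RV P >-> R}) a b c e :
  gaussian_process G -> 0 <= a -> 0 <= b -> 0 <= c -> 0 <= e ->
  incr_cov G a b c e = rect (cov G) a b c e.
Proof.
move=> hG a0 b0 c0 e0.
have i2 t : 0 <= t -> P.-integrable setT (EFin \o (fun w => G t w ^+ 2)).
  move=> t0; apply: gaussian_rv_integrable_sqr.
  have := hG 1%N (fun=> 1) (fun=> t) (fun=> t0).
  by under eq_fun do rewrite big_ord1 mul1r.
have i1 t s : 0 <= t -> 0 <= s -> (G t \* G s)%R \in Lfun P 1.
  move=> t0 s0; apply/Lfun1_integrable.
  apply: (@le_integrable _ _ _ _ _ measurableT _
    (EFin \o (fun w => G t w ^+ 2 + G s w ^+ 2))).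
  - by apply/measurable_EFinP; apply: measurable_funM; exact: measurable_funPT.
  - move=> w _ /=; rewrite lee_fin [leRHS]ger0_norm ?addr_ge0 ?sqr_ge0//.
    rewrite ler_norml; apply/andP; split; nra.
  - exact: (integrableD measurableT (i2 _ t0) (i2 _ s0)).
rewrite /incr_cov /rect /cov.
have -> : ((G b \- G a) \* (G e \- G c))%R =
   (((G b \* G e) \- (G b \* G c)) \- (G a \* G e)) \+ (G a \* G c) :> (Omega -> R).
  by apply/funext => w /=; ring.
have L2 : ((G b \* G e) \- (G b \* G c) : Omega -> R) \in Lfun P 1.
  by apply: rpredB; exact: i1.
have L3 : (((G b \* G e) \- (G b \* G c)) \- (G a \* G e) : Omega -> R) \in Lfun P 1.
  by apply: rpredB => //; exact: i1.
have fin t s : 0 <= t -> 0 <= s -> ('E_P[(G t \* G s)%R])%E \is a fin_num.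
  by move=> t0 s0; apply: expectation_fin_num; exact: i1.
rewrite expectationD ?i1// expectationB ?i1// expectationB ?i1//.
by rewrite fineD ?fineB ?fin_numB ?fin_numD ?fin.
Qed.

(** * Primitives of functions with integrable singularities *)

Section open_interval_integral.
Context (R : realType).
Notation mu := (@lebesgue_measure R).
Implicit Types (f g r A W : R -> R) (a b c : R).

Lemma integral_glue f a c b : a <= c -> c <= b ->
  mu.-integrable `]a, c[ (EFin \o f) -> mu.-integrable `]c, b[ (EFin \o f) ->
  mu.-integrable `]a, b[ (EFin \o f) /\
  \int[mu]_(x in `]a, b[) f x =
    \int[mu]_(x in `]a, c[) f x + \int[mu]_(x in `]c, b[) f x.
Proof.
rewrite le_eqVlt => /predU1P[->|ac] cb iac icb.
  by rewrite set_itvoo0// Rintegral_set0 add0r.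
move: cb icb; rewrite le_eqVlt => /predU1P[<-|cb] icb.
  by rewrite set_itvoo0// Rintegral_set0 addr0.
have mac : measurable_fun `]a, c[ f by apply/measurable_EFinP; exact: measurable_int iac.
have mcb : measurable_fun `]c, b[ f by apply/measurable_EFinP; exact: measurable_int icb.
have E : `]a, b[%classic = (`]a, c] `|` `]c, b[)%classic.
  by apply: itv_bndbnd_setU; rewrite bnd_simp// ltW.
have mac' : measurable_fun `]a, c] f.
  by apply/measurable_fun_itv_bndo_bndcP.
have iab : mu.-integrable `]a, b[ (EFin \o f).
  apply/integrableP; split.
    by rewrite E; apply/measurable_funU => //; split; exact/measurable_EFinP.
  rewrite E ge0_integral_setU//=; last 2 first.
  - apply/measurable_EFinP; apply: measurableT_comp => //.
    by apply/measurable_funU.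
  - apply/disj_set2P; rewrite -subset0 => x []/=; rewrite !in_itv/=.
    by move=> /andP[_ xc] /andP[cx _]; move: (lt_le_trans cx xc); rewrite ltxx.
  rewrite (@integral_itv_bndoo _ a c (fun x => `|f x|%:E)); last first.
    by apply/measurable_EFinP; apply: measurableT_comp.
  rewrite lte_add_pinfty//.
    by have /integrableP[] := iac.
  by have /integrableP[] := icb.
split => //.
have -> : \int[mu]_(x in `]a, c[) f x = \int[mu]_(x in `]a, c]) f x.
  by apply: Rintegral_itv_bndo_bndc.
rewrite -(@Rintegral_itvB _ f (BRight a) (BLeft b) c)//; last by rewrite bnd_simp ltW.
by rewrite addrC subrK.
Qed.

(** Only the increments of [A] and [W] matter. An inequality is enough for [W],
    so that it can be a primitive of a convenient majorant of [|r|]. The interval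
    is open because [r] may be singular, or take a meaningless value, at the
    points where intervals are glued. *)
Definition primitive_on r A W a b : Prop :=
  [/\ mu.-integrable `]a, b[ (EFin \o r),
      \int[mu]_(x in `]a, b[) r x = A b - A a
    & \int[mu]_(x in `]a, b[) `|r x| <= W b - W a].

Lemma primitive_glue r A W a c b : a <= c -> c <= b ->
  primitive_on r A W a c -> primitive_on r A W c b -> primitive_on r A W a b.
Proof.
move=> ac cb [i1 e1 n1] [i2 e2 n2].
have [iab eab] := integral_glue ac cb i1 i2.
have [_ nab] := @integral_glue (fun x => `|r x|) _ _ _ ac cb (integrable_norm i1) (integrable_norm i2).
split => //; first by rewrite eab e1 e2; ring.
by rewrite nab; lra.
Qed.

Lemma eq_primitive r r' A W a b : (forall x, a < x < b -> r x = r' x) ->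
  primitive_on r A W a b -> primitive_on r' A W a b.
Proof.
move=> rr' [i e n].
have E : {in `]a, b[%classic, r =1 r'} by move=> x; rewrite inE/= in_itv => /rr'.
split.
- by apply: eq_integrable i => // x /E /= ->.
- by rewrite -e; apply: eq_Rintegral => x /E ->.
- by apply: le_trans n; rewrite le_eqVlt; apply/orP; left; apply/eqP; apply: eq_Rintegral => x /E ->.
Qed.

Lemma primitiveB r1 A1 W1 r2 A2 W2 a b :
  primitive_on r1 A1 W1 a b -> primitive_on r2 A2 W2 a b ->
  primitive_on (r1 \- r2) (A1 \- A2) (W1 \+ W2) a b.
Proof.
move=> [i1 e1 n1] [i2 e2 n2]; split; first by apply: (integrableB _ i1 i2).
- by rewrite RintegralB// e1 e2 /=; ring.
- apply: (@le_trans _ _ (\int[mu]_(x in `]a, b[) (`|r1 x| + `|r2 x|))).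
    apply: le_Rintegral => //.
    + by apply: integrable_norm; apply: (integrableB _ i1 i2).
    + by apply: (integrableD _ (integrable_norm i1) (integrable_norm i2)).
    + by move=> x _ /=; exact: ler_normB.
  by rewrite RintegralD//=; [lra|exact: integrable_norm..].
Qed.

Lemma primitiveZ k r A W a b : 0 <= k -> primitive_on r A W a b ->
  primitive_on (fun x => k * r x) (fun x => k * A x) (fun x => k * W x) a b.
Proof.
move=> k0 [i e n]; split.
- by apply: (integrableZl _ k i).
- by rewrite RintegralZl// e; ring.
- under eq_Rintegral do rewrite normrM (ger0_norm k0).
  rewrite RintegralZl//; last exact: integrable_norm.
  by rewrite -mulrBr ler_wpM2l.
Qed.

(** The fundamental theorem of calculus for a nonnegative derivative that may
    blow up at the endpoints. *)
Lemma primitive_ge0 r A a b : a <= b -> {within `[a, b], continuous A} ->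
  (forall x, a < x < b -> is_derive x 1 A (r x)) ->
  (forall x, a < x < b -> {for x, continuous r}) ->
  (forall x, a < x < b -> 0 <= r x) -> primitive_on r A A a b.
Proof.
rewrite le_eqVlt => /predU1P[->|ab] cA dA cr r0.
  rewrite /primitive_on set_itvoo0// !Rintegral_set0 !subrr; split=> //.
  exact: integrable_set0.
have mr : measurable_fun `]a, b[ r.
  apply: open_continuous_measurable_fun => // x; rewrite inE/= in_itv; exact: cr.
have [_ Aa Ab] := (continuous_within_itvP A ab).1 cA.
(* The compact intervals [I n] below avoid the endpoints and exhaust ]a, b[. *)
pose d (n : nat) := (b - a) / 2 / n.+2%:R.
have d0 n : 0 < d n by rewrite /d !divr_gt0// subr_gt0.
have dab n : a + d n < b - d n.
  rewrite ltrBrDr -addrA -ltrBrDl -mulr2n -mulr_natr /d mulrAC divfK//.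
  by rewrite ltr_pdivrMr// ltr_pMr ?subr_gt0// ltr1n.
have dle m n : (m <= n)%N -> d n <= d m.
  move=> mn; rewrite /d ler_wpM2l//; first by rewrite divr_ge0// subr_ge0 ltW.
  by rewrite lef_pV2 ?posrE// ler_nat.
have dcvg : d n @[n --> \oo] --> 0.
  rewrite -(mulr0 ((b - a) / 2)); apply: cvgMl_tmp.
  have := @cvg_harmonic R; rewrite /harmonic => h.
  by rewrite -(cvg_shiftn 1) in h; under eq_fun do rewrite -addn1.
pose I n : set R := `[a + d n, b - d n]%classic.
have Iab n x : I n x -> a < x < b.
  rewrite /I/= in_itv/= => /andP[ax xb]; have := d0 n; lra.
have UI : \bigcup_n I n = `]a, b[%classic.
  apply/seteqP; split => x /=; first by move=> [n _ /Iab]; rewrite in_itv.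
  rewrite in_itv/= => /andP[ax xb].
  have e0 : 0 < Num.min (x - a) (b - x) by rewrite lt_min !subr_gt0 ax.
  move/cvgrPdist_lt : dcvg => /(_ _ e0)[N _ /(_ N (leqnn N))].
  rewrite /= sub0r normrN gtr0_norm// lt_min => /andP[h1 h2].
  by exists N => //; rewrite /I/= in_itv/=; lra.
have intI n : (\int[mu]_(x in I n) (r x)%:E = (A (b - d n) - A (a + d n))%:E)%E.
  have sub x : x \in `]a + d n, b - d n[ -> a < x < b.
    by move=> /subset_itv_oo_cc xI; apply: (Iab n).
  rewrite EFinB; apply: continuous_FTC2 => //.
  - apply: continuous_in_subspaceT => x; rewrite inE => /Iab; exact: cr.
  - have cA' x : a < x < b -> A y @[y --> x] --> A x.
      move=> xab; apply: differentiable_continuous; apply/derivable1_diffP.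
      by have [] := dA _ xab.
    split; first by move=> x /sub xab; have [] := dA _ xab.
      apply: cvg_at_right_filter; apply: cA'; apply: (Iab n).
      by rewrite /I/= in_itv/= lexx ltW.
    apply: cvg_at_left_filter; apply: cA'; apply: (Iab n).
    by rewrite /I/= in_itv/= lexx ltW.
  - by move=> x /sub xab; rewrite derive1E; have [_ ->] := dA _ xab.
have mrI n : measurable_fun (I n) (EFin \o r).
  apply/measurable_EFinP; apply: measurable_funS mr => // x /Iab.
  by rewrite /= in_itv.
have ndI : nondecreasing_seq I.
  move=> m n mn; apply/subsetPset => x; rewrite /I/= !in_itv/=.
  by have := dle _ _ mn; lra.
have mI n : measurable (I n) by exact: measurable_itv.
have cvgI : (\int[mu]_(x in I n) (r x)%:E)%E @[n --> \oo] -->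
    (\int[mu]_(x in \bigcup_n I n) (r x)%:E)%E.
  apply: ge0_nondecreasing_set_cvg_integral => //.
  by move=> n x /Iab /r0 rx; rewrite lee_fin.
have cvgA : (A (b - d n) - A (a + d n))%:E @[n --> \oo] --> (A b - A a)%:E.
  apply: cvg_EFin; first by near=> n.
  apply: cvgB.
  - move/cvg_at_leftP : Ab; apply; split; first by move=> n; rewrite ltrBlDr ltrDl.
    by rewrite -[X in _ --> X]subr0; apply: cvgB dcvg; exact: cvg_cst.
  - move/cvg_at_rightP : Aa; apply; split; first by move=> n; rewrite ltrDl.
    by rewrite -[X in _ --> X]addr0; apply: cvgD dcvg; exact: cvg_cst.
have Eint : (\int[mu]_(x in `]a, b[) (r x)%:E = (A b - A a)%:E)%E.
  have E : (fun n => \int[mu]_(x in I n) (r x)%:E)%E =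
      (fun n => (A (b - d n) - A (a + d n))%:E) by apply/funext => n; exact: intI.
  by rewrite E in cvgI; rewrite -UI; exact: (cvg_unique _ cvgI cvgA).
have Eabs : (\int[mu]_(x in `]a, b[) `|r x|%:E = (A b - A a)%:E)%E.
  rewrite -Eint; apply: eq_integral => x; rewrite inE/= in_itv => /r0 rx.
  by rewrite ger0_norm.
split.
- apply/integrableP; split; first exact/measurable_EFinP.
  by rewrite [ltLHS]Eabs ltry.
- by rewrite /Rintegral Eint.
- by rewrite /Rintegral Eabs.
Unshelve. all: by end_near. Qed.

End open_interval_integral.

(** * Weighted Riemann sums *)

Section controlled_functions.
Context (R : realType) (T : R).
Hypothesis T0 : 0 <= T.
Implicit Types (f v r A W : R -> R).
Notation mu := (@lebesgue_measure R).

(** Composing with it turns a function on [[0, T]] into one on the line without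
    changing its monotonicity, which is how measurability is obtained. *)
Definition clamp (x : R) : R := Num.max 0 (Num.min x T).

Lemma clamp_itv x : 0 <= clamp x <= T.
Proof. by rewrite /clamp le_max lexx ge_max T0 ge_min lexx orbT. Qed.

Lemma clamp_id x : 0 <= x <= T -> clamp x = x.
Proof. by move=> /andP[x0 xT]; rewrite /clamp min_l// max_r. Qed.

Lemma clamp_nd x y : x <= y -> clamp x <= clamp y.
Proof.
by move=> xy; rewrite /clamp ge_max !le_max lexx/= le_min !ge_min xy lexx !orbT.
Qed.

Lemma measurable_clamp v f (D : set R) : controls T v f ->
  measurable D -> measurable_fun D (f \o clamp).
Proof.
move=> cf mD.
have -> : f \o clamp = ((f \o clamp) \+ (v \o clamp)) \- (v \o clamp).
  by apply/funext => x /=; rewrite addrK.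
have nd x y : x <= y -> `|f (clamp y) - f (clamp x)| <= v (clamp y) - v (clamp x).
  move=> xy; have /andP[x0 _] := clamp_itv x; have /andP[_ yT] := clamp_itv y.
  by apply: cf => //; exact: clamp_nd.
apply: measurable_funB; apply: nondecreasing_measurable => // x y /nd /=.
  by rewrite ler_norml; lra.
by move=> h; rewrite -subr_ge0 (le_trans _ h).
Qed.

Lemma controls_measurable v f (D : set R) : controls T v f ->
  measurable D -> D `<=` `[0, T]%classic -> measurable_fun D f.
Proof.
move=> cf mD DT; apply: (eq_measurable_fun (f \o clamp)).
  by move=> x; rewrite inE => /DT; rewrite /= in_itv/= => /clamp_id ->.
exact: (measurable_clamp cf).
Qed.

(** On one cell [f] is replaced by its value at the left end; the error is the
    oscillation of [f] times the mass of [|r|]. *)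
Lemma block_bound v f r A W a b : controls T v f -> 0 <= a -> a <= b -> b <= T ->
  primitive_on r A W a b ->
  mu.-integrable `]a, b[ (EFin \o (fun x => f x * r x)) /\
  `|\int[mu]_(x in `]a, b[) (f x * r x) - f a * (A b - A a)|
     <= (v b - v a) * (W b - W a).
Proof.
move=> cf a0 ab bT [ir er nr].
have aT : a <= T by exact: le_trans bT.
have sub x : `]a, b[%classic x -> a <= x /\ x <= b.
  by rewrite /= in_itv => /andP[/ltW ? /ltW ?].
have mf : measurable_fun `]a, b[ f.
  apply: (controls_measurable cf) => // x /sub[ax xb].
  by rewrite /= in_itv/= (le_trans a0)//= (le_trans xb).
have vab : 0 <= v b - v a by rewrite subr_ge0 (controls_le cf).
have bf : [bounded f x | x in `]a, b[%classic].
  exists (`|f 0| + (v T - v 0)); split; first exact: num_real.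
  move=> M hM x /sub[ax xb]; apply/ltW; apply: le_lt_trans hM.
  by apply: (controls_bounded cf); rewrite (le_trans a0)//= (le_trans xb).
have ifr : mu.-integrable `]a, b[ (EFin \o (fun x => f x * r x)).
  have h := @integrableMr _ _ R mu `]a, b[%classic _ f (EFin \o r) mf bf ir.
  exact: h.
split => //.
have iar : mu.-integrable `]a, b[ (EFin \o (fun x => f a * r x)).
  by apply: (integrableZl _ (f a) ir).
rewrite -er -RintegralZl// -RintegralB//.
have idr : mu.-integrable `]a, b[ (EFin \o (fun x => f x * r x - f a * r x)).
  by apply: (integrableB _ ifr iar).
rewrite (le_trans (le_normr_Rintegral _ idr))//.
have inr := integrable_norm ir.
apply: (@le_trans _ _ (\int[mu]_(x in `]a, b[) ((v b - v a) * `|r x|))).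
  apply: le_Rintegral => //.
  - exact: (integrable_norm idr).
  - by apply: (integrableZl _ (v b - v a) inr).
  - move=> x /sub[ax xb]; rewrite -mulrBl normrM ler_wpM2r//.
    rewrite (le_trans (cf _ _ a0 ax (le_trans xb bT)))// lerD2r.
    by rewrite (controls_le cf)// (le_trans a0).
by rewrite RintegralZl// ler_wpM2l.
Qed.

(** The errors of [block_bound] add up to the variation of [f] times the largest
    mass [w] of a cell. *)
Lemma weighted_riemann v f r A W n (w : R) : controls T v f ->
  (forall a b, 0 <= a -> a <= b -> b <= T -> primitive_on r A W a b) ->
  (0 < n)%N ->
  (forall k, (k < n)%N -> W (grid T n k.+1) - W (grid T n k) <= w) ->
  mu.-integrable `]0, T[ (EFin \o (fun x => f x * r x)) /\
  `|\int[mu]_(x in `]0, T[) (f x * r x) -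
    \sum_(k < n) f (grid T n k) * (A (grid T n k.+1) - A (grid T n k))|
     <= w * (v T - v 0).
Proof.
move=> cf pr n0 Ww.
suff main m : (m <= n)%N ->
    mu.-integrable `]0, grid T n m[ (EFin \o (fun x => f x * r x)) /\
    `|\int[mu]_(x in `]0, grid T n m[) (f x * r x) -
      \sum_(k < m) f (grid T n k) * (A (grid T n k.+1) - A (grid T n k))|
       <= w * (v (grid T n m) - v 0).
  by have := main n (leqnn n); rewrite gridn.
elim: m => [|m ih] mn.
  rewrite grid0 set_itvoo0// Rintegral_set0 big_ord0 !subrr normr0 mulr0.
  by split => //; exact: integrable_set0.
have [im em] := ih (ltnW mn).
have g0 : 0 <= grid T n m by exact: grid_ge0.
have gm : grid T n m <= grid T n m.+1 by exact: grid_le.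
have gT : grid T n m.+1 <= T by exact: grid_leT.
have [ib eb] := block_bound cf g0 gm gT (pr _ _ g0 gm gT).
have [ii ei] := integral_glue g0 gm im ib.
split => //; rewrite ei big_ord_recr/= opprD addrACA.
rewrite (le_trans (ler_normD _ _))//.
have -> : w * (v (grid T n m.+1) - v 0) =
  w * (v (grid T n m) - v 0) + w * (v (grid T n m.+1) - v (grid T n m)) by ring.
apply: lerD => //; apply: (le_trans eb); rewrite mulrC ler_wpM2r ?Ww//.
by rewrite subr_ge0 (controls_le cf).
Qed.

End controlled_functions.

Section singular_primitives.
Context (R : realType).

Lemma primitive_mass (H a b : R) : 0 < H -> 0 <= a -> a <= b ->
  primitive_on (fun x => x `^ (H - 1)) (fun x => x `^ H / H)
    (fun x => x `^ H / H) a b.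
Proof.
move=> H0 a0 ab.
have pos x : a < x < b -> 0 < x by move=> /andP[/(le_lt_trans a0)].
apply: primitive_ge0 => //.
- have cc : {within `[a, b], continuous (fun x => absp H x / H)}.
    apply: continuous_subspaceT => x; apply: cvgMr_tmp.
    exact: continuous_absp.
  have E : {in `[a, b]%classic, (fun x => absp H x / H) =1 (fun x => x `^ H / H)}.
    move=> x; rewrite inE/= in_itv/= => /andP[ax _].
    by rewrite /absp ger0_norm// (le_trans a0).
  exact: (subspace_eq_continuous E cc).
- move=> x /pos x0.
  have d1 := is_derive1_powR H x0.
  have -> : x `^ (H - 1) = H^-1 *: (H * x `^ (H - 1)).
    by rewrite /GRing.scale/= mulrA mulVf ?mul1r// gt_eqF.
  have -> : (fun x => x `^ H / H) = H^-1 \*: (fun x => x `^ H).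
    by apply/funext => y; rewrite /= /GRing.scale/= mulrC.
  exact: is_deriveZ.
- move=> x /pos x0; apply: differentiable_continuous; apply/derivable1_diffP.
  by have [] := is_derive1_powR (H - 1) x0.
- by move=> x _; exact: powR_ge0.
Qed.

Lemma continuous_dabsp (p x : R) : x != 0 -> {for x, continuous (dabsp p)}.
Proof.
have pos y : 0 < y -> {for y, continuous (fun z => z `^ (p - 1))}.
  move=> y0; apply: differentiable_continuous; apply/derivable1_diffP.
  by have [] := is_derive1_powR (p - 1) y0.
move=> x0; have [xgt|xlt] : 0 < x \/ x < 0 by case: ltgtP x0 => //; auto.
- have c : {for x, continuous (fun y => p * y `^ (p - 1))}.
    by apply: cvgMl_tmp; exact: pos.
  have -> : {for x, continuous (dabsp p)} =
      (dabsp p y @[y --> x] --> p * x `^ (p - 1)).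
    by rewrite /prop_for /continuous_at /dabsp gtr0_sg// mulr1 gtr0_norm.
  apply: cvg_trans c; apply: near_eq_cvg; near=> y.
  have y0 : 0 < y by near: y; exact: lt_nbhsr.
  by rewrite /dabsp gtr0_sg// mulr1 gtr0_norm.
- have Nx : 0 < - x by rewrite oppr_gt0.
  have c : p * - 1 * (- y) `^ (p - 1) @[y --> x] --> p * - 1 * (- x) `^ (p - 1).
    apply: cvgMl_tmp.
    have cN : - y @[y --> x] --> - x by apply: cvgN; exact: cvg_id.
    exact: (cvg_comp -%R (fun z => z `^ (p - 1)) cN (pos _ Nx)).
  have -> : {for x, continuous (dabsp p)} =
      (dabsp p y @[y --> x] --> p * - 1 * (- x) `^ (p - 1)).
    by rewrite /prop_for /continuous_at /dabsp ltr0_sg// ltr0_norm.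
  apply: cvg_trans c; apply: near_eq_cvg; near=> y.
  have y0 : y < 0 by near: y; exact: lt_nbhsl.
  by rewrite /dabsp ltr0_sg// ltr0_norm.
Unshelve. all: by end_near. Qed.

(** This is [sgn x * `|x| `^ p], whose derivative is the absolute value of that of
    [absp]. Written with the positive and negative parts of [x], it is visibly
    continuous. *)
Definition sabsp (p x : R) : R :=
  absp p ((x + `|x|) / 2) - absp p ((x - `|x|) / 2).

Lemma sabsp_ge0 p x : 0 < p -> 0 <= x -> sabsp p x = absp p x.
Proof.
move=> p0 x0; rewrite /sabsp ger0_norm// subrr mul0r absp0// subr0.
by congr absp; field.
Qed.

Lemma sabsp_le0 p x : 0 < p -> x <= 0 -> sabsp p x = - absp p x.
Proof.
move=> p0 x0; rewrite /sabsp ler0_norm// subrr mul0r absp0// sub0r.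
by congr (- absp _ _); field.
Qed.

Lemma continuous_sabsp p : 0 < p -> continuous (sabsp p).
Proof.
move=> p0 x; have ca y := @continuous_absp _ _ p0 y.
have cn : `|y| @[y --> x] --> `|x| by apply: cvg_norm; exact: cvg_id.
have c1 : (y + `|y|) / 2 @[y --> x] --> (x + `|x|) / 2.
  by apply: cvgMr_tmp; apply: cvgD cn; exact: cvg_id.
have c2 : (y - `|y|) / 2 @[y --> x] --> (x - `|x|) / 2.
  by apply: cvgMr_tmp; apply: cvgB cn; exact: cvg_id.
apply: cvgB.
- exact: (cvg_comp _ (absp p) c1 (ca _)).
- exact: (cvg_comp _ (absp p) c2 (ca _)).
Qed.

Lemma primitive_dabsp (p s a b : R) : 0 < p -> s <= a -> a <= b ->
  primitive_on (fun t => dabsp p (t - s)) (fun t => absp p (t - s))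
    (fun t => absp p (t - s)) a b.
Proof.
move=> p0 sa ab.
have pos t : a < t < b -> 0 < t - s by move=> /andP[/(le_lt_trans sa)]; rewrite subr_gt0.
have cs (t : R) : t' - s @[t' --> t] --> t - s.
  by apply: cvgB; [exact: cvg_id|exact: cvg_cst].
apply: primitive_ge0.
- exact: ab.
- apply: continuous_subspaceT => t.
  exact: (cvg_comp (fun t => t - s) (absp p) (cs t) (@continuous_absp _ _ p0 _)).
- move=> t /pos ts.
  have d3 : is_derive (t - s) 1 (absp p) (dabsp p (t - s)).
    by apply: is_derive_absp; rewrite gt_eqF.
  have d4 : is_derive t 1 (fun t => t - s) 1.
    by apply: is_derive_eq; rewrite subr0.
  by have := @is_derive1_comp _ (absp p) (fun t => t - s) t _ _ d3 d4; rewrite mulr1.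
- move=> t /pos ts.
  apply: (cvg_comp (fun t => t - s) (dabsp p) (cs t)).
  by apply: continuous_dabsp; rewrite gt_eqF.
- move=> t /pos ts; rewrite /dabsp gtr0_sg// mulr1 mulr_ge0 ?powR_ge0//.
  exact: ltW.
Qed.

(** The derivative in [t] of the covariance [RB H t s] is the difference of two
    terms, each of which has a constant sign on both sides of [s]; [WB] is a
    primitive of the sum of their absolute values. Its modulus of continuity in
    [t] is uniform in [s]. *)
Definition WB (H s t : R) : R :=
  2^-1 * (absp (2 * H) t + sabsp (2 * H) (t - s)).

(** The singularities are at 0 and at [s]. To the left of [s] the derivative is
    nonnegative; to its right it is a difference of two nonnegative functions. *)
Lemma primitive_dRB (H s a b : R) : 0 < H -> 0 <= s -> 0 <= a -> a <= b ->
  primitive_on (dRB H ^~ s) (RB H ^~ s) (WB H s) a b.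
Proof.
move=> H0 s0 a0 ab; have p0 : 0 < 2 * H by rewrite mulr_gt0.
have left_ c e : 0 <= c -> c <= e -> e <= s ->
    primitive_on (dRB H ^~ s) (RB H ^~ s) (WB H s) c e.
  move=> c0 ce es.
  have in0s t : c < t < e -> [/\ 0 < t, t < s & t != s].
    move=> /andP[ct te]; have ts : t < s := lt_le_trans te es.
    by split; [exact: le_lt_trans ct|by []|rewrite lt_eqF].
  apply: (@eq_primitive _ (dRBf H ^~ s)).
    by move=> t /in0s[t0 _ ts]; rewrite dRBE.
  have [i e1 n1] : primitive_on (dRBf H ^~ s) (RB H ^~ s) (RB H ^~ s) c e.
    apply: primitive_ge0.
    - exact: ce.
    - exact: (continuous_cov_slice (continuous_cov_RB H0) c0 s0).
    - by move=> t /in0s[t0 _ ts]; exact: is_derive_RB.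
    - move=> t /in0s[t0 _ ts]; apply: cvgMl_tmp; apply: cvgB.
        by apply: continuous_dabsp; rewrite gt_eqF.
      have cs : t' - s @[t' --> t] --> t - s.
        by apply: cvgB; [exact: cvg_id|exact: cvg_cst].
      apply: (cvg_comp (fun t => t - s) (dabsp (2 * H)) cs).
      by apply: continuous_dabsp; rewrite subr_eq0.
    - move=> t /in0s[t0 ts _]; rewrite /dRBf /dabsp gtr0_sg// mulr1.
      rewrite ltr0_sg ?subr_lt0// mulrN1 mulNr opprK mulr_ge0//.
      by rewrite addr_ge0// mulr_ge0 ?powR_ge0// ltW.
  split => //.
  suff -> : WB H s e - WB H s c = RB H e s - RB H c s by [].
  rewrite /WB !sabsp_le0 ?subr_le0// ?(le_trans ce)// !RB_absp//; first by ring.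
  exact: le_trans ce.
have right_ c e : s <= c -> c <= e ->
    primitive_on (dRB H ^~ s) (RB H ^~ s) (WB H s) c e.
  move=> sc ce.
  have c0 : 0 <= c by exact: le_trans sc.
  apply: (@eq_primitive _ (dRBf H ^~ s)).
    move=> t /andP[ct te]; rewrite dRBE//; first exact: le_lt_trans ct.
    by rewrite gt_eqF// (le_lt_trans sc).
  have pu : primitive_on (dabsp (2 * H)) (absp (2 * H)) (absp (2 * H)) c e.
    have := primitive_dabsp p0 c0 ce.
    have -> : (fun t => dabsp (2 * H) (t - 0)) = dabsp (2 * H).
      by apply/funext => t; rewrite subr0.
    by have -> : (fun t => absp (2 * H) (t - 0)) = absp (2 * H)
      by apply/funext => t; rewrite subr0.
  have pv := primitive_dabsp p0 sc ce.
  have h2 : 0 <= 2^-1 :> R by rewrite invr_ge0.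
  have [i e1 n1] := primitiveZ h2 (primitiveB pu pv).
  have e0 : 0 <= e by exact: le_trans ce.
  split.
  - exact: i.
  - by rewrite [LHS]e1 !RB_absp//=; ring.
  - by rewrite /WB !sabsp_ge0 ?subr_ge0// (le_trans sc).
have [bs|/ltW sb] := leP b s; first exact: left_.
have [as_|/ltW sa] := leP a s; last exact: right_.
by apply: (primitive_glue as_ sb); [exact: left_|exact: right_].
Qed.

End singular_primitives.

(** * Riemann sums for [mu2] *)

Lemma grid_modulus (R : realType) (T w : R) (W : R -> R) : 0 <= T -> 0 < w ->
  {within `[0, T], continuous W} ->
  \forall n \near \oo, forall k, (k < n)%N ->
    W (grid T n k.+1) - W (grid T n k) <= w.
Proof.
move=> T0 w0 cW.
have [d d0 Wd] := compact_unif_cont (@segment_compact _ 0 T) cW w0.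
near=> n; move=> k kn.
have [n0 nd] : (0 < n)%N /\ T / n%:R < d by near: n; exact: near_mesh.
rewrite (le_trans (ler_norm _))//; apply/ltW/Wd => /=.
- by rewrite in_itv/= grid_ge0// grid_leT.
- by rewrite in_itv/= grid_ge0// grid_leT// ltnW.
- by rewrite /ball/= grid_step ger0_norm// divr_ge0.
Unshelve. all: by end_near. Qed.

Section mu2_riemann.
Context (R : realType) (T H : R).
Hypotheses (T0 : 0 <= T) (H0 : 0 < H).
Notation mu := (@lebesgue_measure R).
Notation sq := (`[0, T]%classic `*` `[0, T]%classic).

Let w (x : R) := x `^ (H - 1).
Let W (x : R) := x `^ H / H.

Let w_ge0 x : 0 <= w x. Proof. exact: powR_ge0. Qed.

Let cW : {within `[0, T], continuous W}.
Proof.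
have cc : {within `[0, T], continuous (fun x => absp H x / H)}.
  by apply: continuous_subspaceT => x; apply: cvgMr_tmp; exact: continuous_absp.
have E : {in `[0, T]%classic, (fun x => absp H x / H) =1 W}.
  move=> x; rewrite inE/= in_itv/= => /andP[x0 _].
  by rewrite /absp /W ger0_norm.
exact: (subspace_eq_continuous E cc).
Qed.

Let prim a b : 0 <= a -> a <= b -> b <= T -> primitive_on w W W a b.
Proof. by move=> a0 ab _; exact: primitive_mass. Qed.

Let massE a b : mass H a b = W b - W a.
Proof. by rewrite /mass /W mulrBl. Qed.

Let M := mass H 0 T.

Let mass_sum n : (0 < n)%N ->
  \sum_(k < n) mass H (grid T n k) (grid T n k.+1) = M.
Proof.
move=> n0; rewrite -(big_mkord xpredT (fun k => mass H (grid T n k) (grid T n k.+1))).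
under eq_bigr do rewrite massE.
by rewrite (telescope_sumr (fun k => W (grid T n k)))// grid0 gridn// /M massE.
Qed.

Lemma integral_open_closed (f : R -> R) : mu.-integrable `]0, T[ (EFin \o f) ->
  (\int[mu]_(x in `[0%R, T]) (f x)%:E = (\int[mu]_(x in `]0%R, T[) f x)%:E)%E.
Proof.
move=> i; rewrite integral_itv_bndoo; last exact: measurable_int i.
by rewrite /Rintegral fineK//; exact: integrable_fin_num.
Qed.

(** By Tonelli, [mu2] is an iterated integral, and [weighted_riemann] applies to
    each of the two integrations: the inner integral, as a function of the outer
    variable, inherits the variation of [F], multiplied by the total mass. *)
Lemma mu2_cvg (F : R -> R -> R) (v1 v2 : R -> R) :
  (forall y, 0 <= y <= T -> controls T v1 (F ^~ y)) ->
  (forall x, 0 <= x <= T -> controls T v2 (F x)) ->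
  (forall x y, 0 <= x <= T -> 0 <= y <= T -> 0 <= F x y) ->
  measurable_fun sq (fun z : measurableTypeR R * measurableTypeR R => F z.1 z.2) ->
  exists2 m : R, mu2 H T F = m%:E &
    (\sum_(a < n) \sum_(b < n) F (grid T n a) (grid T n b) *
       (mass H (grid T n a) (grid T n a.+1) * mass H (grid T n b) (grid T n b.+1)))
      @[n --> \oo] --> m.
Proof.
move=> c1 c2 F0 mF.
pose J x := \int[mu]_(y in `]0, T[) (F x y * w y).
have in0T x : `]0, T[%classic x -> 0 <= x <= T.
  by rewrite /= in_itv => /andP[/ltW -> /ltW ->].
have W1 k : (k < 1)%N -> W (grid T 1 k.+1) - W (grid T 1 k) <= W T - W 0.
  by case: k => // _; rewrite grid0 gridn.
have iF x : 0 <= x <= T -> mu.-integrable `]0, T[ (EFin \o (fun y => F x y * w y)).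
  by move=> xT; have [] := weighted_riemann T0 (c2 x xT) prim (ltn0Sn 0) W1.
have iw : mu.-integrable `]0, T[ (EFin \o w).
  by have [] := prim (lexx 0) T0 (lexx T).
have Mw : \int[mu]_(y in `]0, T[) w y = M.
  by have [_ -> _] := prim (lexx 0) T0 (lexx T); rewrite /M massE.
have cJ : controls T (fun x => M * v1 x) J.
  move=> x y x0 xy yT.
  have xT : 0 <= x <= T by rewrite x0 (le_trans xy).
  have yT' : 0 <= y <= T by rewrite (le_trans x0).
  have id : mu.-integrable `]0, T[ (EFin \o (fun z => F y z * w z - F x z * w z)).
    by apply: (integrableB _ (iF y yT') (iF x xT)).
  rewrite /J -RintegralB//; [|exact: iF..].
  rewrite (le_trans (le_normr_Rintegral _ id))//.
  apply: (@le_trans _ _ (\int[mu]_(z in `]0, T[) ((v1 y - v1 x) * w z))).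
    apply: le_Rintegral => //.
    - exact: (integrable_norm id).
    - exact: (integrableZl _ (v1 y - v1 x) iw).
    - move=> z /in0T zT; rewrite -mulrBl normrM [`|w z|]ger0_norm//.
      by rewrite ler_wpM2r// (c1 z zT).
  by rewrite RintegralZl// Mw -mulrBr mulrC.
have iJ : mu.-integrable `]0, T[ (EFin \o (fun x => J x * w x)).
  by have [] := weighted_riemann T0 cJ prim (ltn0Sn 0) W1.
exists (\int[mu]_(x in `]0, T[) (J x * w x)).
  have msq : measurable sq by apply: measurableX; exact: measurable_itv.
  pose g (z : measurableTypeR R * measurableTypeR R) : \bar R :=
    (F z.1 z.2 * z.1 `^ (H - 1) * z.2 `^ (H - 1))%:E.
  have mp : measurable_fun [set: measurableTypeR R]
    (fun x : measurableTypeR R => ((x : R) `^ (H - 1) : R)).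
    exact: measurable_powR.
  have mg : measurable_fun sq g.
    apply/measurable_EFinP; apply: measurable_funM; first apply: measurable_funM => //.
    - by apply: measurable_funTS; exact: (measurable_comp measurableT _ mp measurable_fst).
    - by apply: measurable_funTS; exact: (measurable_comp measurableT _ mp measurable_snd).
  have g0 z : (0 <= (g \_ sq) z)%E.
    rewrite /patch; case: ifPn => //; rewrite inE => -[/=].
    rewrite !in_itv/= => xT yT.
    by rewrite lee_fin !mulr_ge0 ?powR_ge0// F0.
  rewrite /mu2 -/g integral_mkcond fubini_tonelli1//=; last first.
    by apply/measurable_restrict => //; rewrite setTI.
  rewrite -integral_open_closed// [RHS]integral_mkcond; apply: eq_integral => x _.
  rewrite /fubini_F /patch; case: ifPn => xT.
    move: (xT); rewrite inE/= in_itv/= => xT'.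
    rewrite EFinM /J -integral_open_closed ?iF//.
    rewrite -ge0_integralZr//; last 3 first.
    - apply/measurable_EFinP; apply: measurable_funM.
        exact: (controls_measurable T0 (c2 x xT')).
      by apply: measurable_funTS; exact: measurable_powR.
    - move=> y; rewrite /= in_itv/= => yT.
      by rewrite lee_fin mulr_ge0//; apply: F0.
    - by rewrite lee_fin.
    rewrite [RHS]integral_mkcond; apply: eq_integral => y _.
    rewrite /patch; have [yT|yT] := boolP (y \in `[0, T]%classic).
      rewrite ifT; last by rewrite inE; split => /=; exact/set_mem.
      by rewrite -EFinM /w; congr EFin; ring.
    rewrite ifF//; apply/negbTE; apply: contra yT; rewrite !inE.
    by case.
  apply: integral0_eq => y _; rewrite ifF//; apply/negbTE.
  by apply: contra xT; rewrite !inE; case.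
apply/cvgrPdist_le => e e0.
have vT1 : 0 <= v1 T - v1 0.
  by rewrite subr_ge0 (controls_le (c1 0 _))// lexx.
have vT2 : 0 <= v2 T - v2 0.
  by rewrite subr_ge0 (controls_le (c2 0 _))// lexx.
have M0 : 0 <= M by rewrite /M mass_ge0.
pose k := (M + 1) * (v1 T - v1 0 + (v2 T - v2 0) + 1).
have k0 : 0 < k by rewrite /k; nra.
have ek0 : 0 < e / k by rewrite divr_gt0.
near=> n.
have n0 : (0 < n)%N by near: n; exists 1%N.
have Wn k' : (k' < n)%N -> W (grid T n k'.+1) - W (grid T n k') <= e / k.
  by move: k'; near: n; exact: grid_modulus.
have [_ e1] := weighted_riemann T0 cJ prim n0 Wn.
have e2 x : 0 <= x <= T -> `|J x - \sum_(b < n) F x (grid T n b) *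
    mass H (grid T n b) (grid T n b.+1)| <= e / k * (v2 T - v2 0).
  move=> xT; have [_] := weighted_riemann T0 (c2 x xT) prim n0 Wn.
  by under eq_bigr do rewrite -massE.
pose S x := \sum_(b < n) F x (grid T n b) * mass H (grid T n b) (grid T n b.+1).
have -> : \sum_(a < n) \sum_(b < n) F (grid T n a) (grid T n b) *
       (mass H (grid T n a) (grid T n a.+1) * mass H (grid T n b) (grid T n b.+1)) =
    \sum_(a < n) S (grid T n a) * mass H (grid T n a) (grid T n a.+1).
  apply: eq_bigr => a _; rewrite /S mulr_suml; apply: eq_bigr => b _; ring.
set I := \int[mu]_(x in _) _.
have mg (a : 'I_n) : 0 <= mass H (grid T n a) (grid T n a.+1).
  by rewrite mass_ge0 ?grid_ge0 ?grid_le.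
have gT (a : 'I_n) : 0 <= grid T n a <= T by rewrite grid_ge0//= grid_leT// ltnW.
have e3 : `|\sum_(a < n) J (grid T n a) * mass H (grid T n a) (grid T n a.+1) -
   \sum_(a < n) S (grid T n a) * mass H (grid T n a) (grid T n a.+1)| <=
   e / k * (v2 T - v2 0) * M.
  rewrite -sumrB -(mass_sum n0) mulr_sumr (le_trans (ler_norm_sum _ _ _))//.
  apply: ler_sum => a _; rewrite -mulrBl normrM (ger0_norm (mg a)) ler_wpM2r//.
  exact: e2.
move: e1; under eq_bigr do rewrite -massE; move=> e1.
rewrite -(subrKA (\sum_(a < n) J (grid T n a) * mass H (grid T n a) (grid T n a.+1))).
rewrite (le_trans (ler_normD _ _))// (le_trans (lerD e1 e3))//.
have -> : e / k * (M * v1 T - M * v1 0) + e / k * (v2 T - v2 0) * M =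
  e / k * (M * (v1 T - v1 0 + (v2 T - v2 0))) by ring.
rewrite -[leRHS](divfK (lt0r_neq0 k0)) ler_wpM2l ?(ltW ek0)//.
by rewrite /k; nra.
Unshelve. all: by end_near. Qed.

End mu2_riemann.

(** * Existence of Lebesgue-Stieltjes charges *)

Section lebesgue_stieltjes_existence.
Context (R : realType).
Implicit Types A B F : R -> R.

Definition rlim F (x : R) : R := lim (F y @[y --> x^'+]).

Section monotone.
Variable A : R -> R.
Hypothesis ndA : {homo A : x y / x <= y}.

Lemma rlim_cvg x : A y @[y --> x^'+] --> rlim A x.
Proof.
apply: nondecreasing_at_right_is_cvgr.
- by near=> y => a b _ _; exact: ndA.
- near=> y; exists (A x) => _ [z + <-].
  by rewrite /= in_itv => /andP[/ltW xz _]; exact: ndA.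
Unshelve. all: by end_near. Qed.

Lemma rlim_ge x : A x <= rlim A x.
Proof.
apply: limr_ge; first by apply: cvgP; exact: rlim_cvg.
near=> y; apply: ndA; apply/ltW; near: y; exact: nbhs_right_gt.
Unshelve. all: by end_near. Qed.

Lemma rlim_le x y : x < y -> rlim A x <= A y.
Proof.
move=> xy; apply: limr_le; first by apply: cvgP; exact: rlim_cvg.
near=> z; apply: ndA; apply/ltW; near: z; exact: nbhs_right_lt.
Unshelve. all: by end_near. Qed.

Lemma rlim_nd : {homo rlim A : x y / x <= y}.
Proof.
move=> x y; rewrite le_eqVlt => /predU1P[->//|xy].
exact: le_trans (rlim_le xy) (rlim_ge y).
Qed.

Lemma rlim_rc : right_continuous (rlim A).
Proof.
move=> x; apply/cvgrPdist_lt => e e0.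
have /cvgrPdist_lt /(_ _ e0) hA := @rlim_cvg x.
near (x^'+) => z.
have xz : x < z by near: z; exact: nbhs_right_gt.
have hz : `|rlim A x - A z| < e by near: z.
near=> y.
have xy : x < y by near: y; exact: nbhs_right_gt.
have yz : y < z by near: y; exact: nbhs_right_lt.
have h1 := rlim_nd (ltW xy); have h2 := rlim_le yz; have h3 := rlim_le xz.
rewrite distrC ger0_norm ?subr_ge0//; move: hz.
rewrite distrC ger0_norm ?subr_ge0//; lra.
Unshelve. all: by end_near. Qed.

(** The charge is the Lebesgue-Stieltjes measure of the right limits of [A], which
    form a cumulative function; boundedness makes it finite. *)
Lemma LS_charge_monotone (c : R) : (forall x, 0 <= A x <= c) ->
  exists nu, @is_LS_charge R A nu.
Proof.
move=> Ac.
pose mix := isCumulative.Build R _ R (rlim A) rlim_nd rlim_rc.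
pose f : cumulative R R := HB.pack (rlim A) mix.
pose m := lebesgue_stieltjes_measure f.
have mE a b : a <= b -> m `]a, b]%classic = (rlim A b - rlim A a)%:E.
  move=> ab; rewrite /m /lebesgue_stieltjes_measure /measure_extension.
  rewrite measurable_mu_extE/=; last exact: is_ocitv.
  by rewrite wlength_itv_bnd.
have rc x : 0 <= rlim A x <= c.
  apply/andP; split; first by apply: le_trans (rlim_ge x); case/andP: (Ac x).
  by apply: (le_trans (@rlim_le x (x + 1) _)); [rewrite ltrDl|case/andP: (Ac (x + 1))].
have fin : fin_num_fun m.
  apply: lty_fin_num_fun.
  rewrite -(bigcup_itvT false false).
  pose I n : set R := `]- (n%:R), n%:R]%classic.
  have cI : (m \o I) n @[n --> \oo] --> m (\bigcup_n I n).
    apply: nondecreasing_cvg_mu; rewrite /I//; first exact: bigcup_measurable.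
    by move=> *; apply/subsetPset/subset_itv; rewrite leBSide/= ?lerN2 ler_nat.
  apply: (@le_lt_trans _ _ c%:E); last exact: ltry.
  apply: (cvge_to_le cI); near=> n => /=.
  rewrite /I mE; last by rewrite ge0_cp.
  have /andP[_ h1] := rc n%:R; have /andP[h2 _] := rc (- n%:R).
  by rewrite lee_fin; lra.
pose mixm := @Measure_isFinite.Build _ _ _ m fin.
pose mf : {finite_measure set (measurableTypeR R) -> \bar R} := HB.pack m mixm.
exists (charge_of_finite_measure mf) => a b ab.
exact: mE.
Unshelve. all: by end_near. Qed.

End monotone.

Lemma rlimB A B x : {homo A : x y / x <= y} -> {homo B : x y / x <= y} ->
  (A \- B) y @[y --> x^'+] --> rlim A x - rlim B x.
Proof. by move=> hA hB; apply: cvgB; exact: rlim_cvg. Qed.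

Lemma LS_charge_difference A B (c : R) :
  {homo A : x y / x <= y} -> {homo B : x y / x <= y} ->
  (forall x, 0 <= A x <= c) -> (forall x, 0 <= B x <= c) ->
  exists nu, @is_LS_charge R (A \- B) nu.
Proof.
move=> hA hB Ac Bc.
have [nA nAE] := LS_charge_monotone hA Ac.
have [nB nBE] := LS_charge_monotone hB Bc.
exists (cadd nA (cscale (-1) nB)) => a b ab.
transitivity (nA `]a, b]%classic + (-1)%:E * nB `]a, b]%classic)%E.
  by [].
rewrite (nAE a b ab) (nBE a b ab).
have E y : lim ((A \- B) x @[x --> y^'+]) = rlim A y - rlim B y.
  by apply: cvg_lim => //; exact: rlimB.
rewrite !E -!/(rlim _ _) -EFinM -EFinD; congr EFin; ring.
Qed.

Variable T : R.
Hypothesis T0 : 0 < T.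

(** Extends a nonnegative nondecreasing function on [[0, T]] to a bounded
    nondecreasing one on the line. The free value [c] beyond [T] allows two such
    extensions to coincide there, and so to cancel in a difference. *)
Definition step_ext (h : R -> R) (c x : R) : R :=
  if x < 0 then 0 else if x < T then h x else c.

Lemma step_ext_bound h c x :
  (forall x y, 0 <= x -> x <= y -> y <= T -> h x <= h y) ->
  0 <= h 0 -> h T <= c -> 0 <= step_ext h c x <= c.
Proof.
move=> hh h0 hT.
have hTge : h 0 <= h T by rewrite hh// ltW.
have c0 : 0 <= c by exact: le_trans (le_trans h0 hTge) hT.
rewrite /step_ext; case: ltP => x0; first by rewrite lexx.
case: ltP => xT; last by rewrite c0 lexx.
by rewrite (le_trans h0 (hh _ _ _ _ _))//= ?(le_trans (hh _ _ _ _ _) hT)// ltW.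
Qed.

Lemma step_ext_nd h c :
  (forall x y, 0 <= x -> x <= y -> y <= T -> h x <= h y) ->
  0 <= h 0 -> h T <= c -> {homo step_ext h c : x y / x <= y}.
Proof.
move=> hh h0 hT x y xy.
have [y0|y0] := ltP y 0.
  by rewrite /step_ext y0 (le_lt_trans xy y0).
have [x0|x0] := ltP x 0.
  by rewrite {1}/step_ext x0; case/andP: (step_ext_bound y hh h0 hT).
have [yT|yT] := ltP y T; last first.
  rewrite {2}/step_ext ltNge y0/= ltNge yT/=.
  by case/andP: (step_ext_bound x hh h0 hT).
rewrite /step_ext !ltNge x0 y0/= -!ltNge yT (le_lt_trans xy yT).
by rewrite hh// ltW.
Qed.

Variables v g : R -> R.
Hypothesis cg : controls T v g.

(* The constant makes both [p] and [q] nonnegative at 0. *)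
Let p x := v x - v 0 + `|g 0|.
Let q x := p x - g x.

Let p_nd x y : 0 <= x -> x <= y -> y <= T -> p x <= p y.
Proof. by move=> x0 xy yT; rewrite lerD2r lerD2r (controls_le cg). Qed.

Let q_nd x y : 0 <= x -> x <= y -> y <= T -> q x <= q y.
Proof.
move=> x0 xy yT; have := cg x0 xy yT; rewrite /q /p ler_norml; lra.
Qed.

Let p0 : 0 <= p 0. Proof. by rewrite /p subrr add0r. Qed.

Let q0 : 0 <= q 0.
Proof. by rewrite /q /p subrr add0r subr_ge0 ler_norm. Qed.

Let c := p T + q T.

Let pT : p T <= c.
Proof. by rewrite lerDl (le_trans q0)// q_nd// ltW. Qed.

Let qT : q T <= c.
Proof. by rewrite lerDr (le_trans p0)// p_nd// ltW. Qed.

Let zero_extE : zero_ext T g = step_ext p c \- step_ext q c.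
Proof.
apply/funext => x; rewrite /zero_ext /step_ext /= indicE mem_setE in_itv/=.
case: (ltP x 0) => x0 /=; first by rewrite mulr0 subrr.
case: (ltP x T) => xT /=; first by rewrite mulr1 /q opprB addrC subrK.
by rewrite mulr0 subrr.
Qed.

Lemma LS_chargeP : is_LS_charge (zero_ext T g) (LS_charge (zero_ext T g)).
Proof.
rewrite /LS_charge; case: pselect => [e|]; first exact: (projT2 (cid e)).
case; rewrite zero_extE.
apply: (@LS_charge_difference _ _ c); try exact: step_ext_nd.
- by move=> x; exact: step_ext_bound.
- by move=> x; exact: step_ext_bound.
Qed.

Let zero_ext_cvg x : zero_ext T g y @[y --> x^'+] --> rlim (zero_ext T g) x.
Proof.
have h : zero_ext T g y @[y --> x^'+] -->
    rlim (step_ext p c) x - rlim (step_ext q c) x.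
  by rewrite zero_extE; apply: rlimB; exact: step_ext_nd.
by rewrite /rlim (cvg_lim _ h).
Qed.

Lemma rlim_zero_extT : rlim (zero_ext T g) T = 0.
Proof.
apply: cvg_lim => //.
have c0 : (fun=> 0 : R) y @[y --> T^'+] --> (0 : R) by exact: cvg_cst.
apply: cvg_trans c0; apply: near_eq_cvg; near=> y.
rewrite /zero_ext indicE mem_setE in_itv/= [y < T]ltNge.
have -> : T <= y by apply: ltW; near: y; exact: nbhs_right_gt.
by rewrite andbF mulr0.
Unshelve. all: by end_near. Qed.

(** The charge only sees the right limits of [g], whereas the grid sums use its
    values; the discrepancy is bounded by the variation of [g] on one cell. *)
Lemma rlim_zero_ext x y : 0 <= x -> x < y -> y <= T ->
  `|rlim (zero_ext T g) x - g x| <= v y - v x.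
Proof.
move=> x0 xy yT.
have h : `|zero_ext T g z - g x| @[z --> x^'+] --> `|rlim (zero_ext T g) x - g x|.
  by apply: cvg_norm; apply: cvgB; [exact: zero_ext_cvg|exact: cvg_cst].
rewrite -(cvg_lim _ h)//; apply: limr_le; first exact: (cvgP _ h).
near=> z.
have xz : x <= z by apply: ltW; near: z; exact: nbhs_right_gt.
have zy : z < y by near: z; exact: nbhs_right_lt.
rewrite /zero_ext indicE mem_setE in_itv/= (le_trans x0 xz) (lt_le_trans zy yT)/= mulr1.
have zT : z <= T by rewrite (le_trans (ltW zy)).
rewrite (le_trans (cg x0 xz zT))// lerD2r (controls_le cg)// ?(le_trans x0)//.
exact: ltW.
Unshelve. all: by end_near. Qed.

End lebesgue_stieltjes_existence.

(** * Integrals with respect to a charge *)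

Section finite_measure_sums.
Context (R : realType) (T : R).
Hypothesis T0 : 0 < T.
Variable m : {finite_measure set (measurableTypeR R) -> \bar R}.

Let T0' : 0 <= T. Proof. exact: ltW. Qed.

(** The half-open cells cover all of [[0, T]] except 0, where [h] vanishes. *)
Lemma integral_grid_approx (h : R -> R) (n : nat) (w : R) :
  {within `[0, T], continuous h} -> h 0 = 0 -> (0 < n)%N ->
  (forall k x, (k < n)%N -> grid T n k <= x -> x <= grid T n k.+1 ->
     `|h x - h (grid T n k.+1)| <= w) ->
  `|\int[m]_(x in `[0, T]) h x - \sum_(k < n)
     h (grid T n k.+1) * fine (m `]grid T n k, grid T n k.+1]%classic)| <=
  w * fine (m `[0, T]%classic).
Proof.
move=> ch h0 n0 hw.
have w0 : 0 <= w.
  have := hw 0%N (grid T n 1) n0; rewrite grid0 grid_ge0// => /(_ isT (lexx _)).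
  exact: le_trans.
have mI (i : interval R) : measurable ([set` i] : set (measurableTypeR R)).
  exact: measurable_itv.
have mh : measurable_fun (`[0, T]%classic : set (measurableTypeR R)) h.
  exact: (subspace_continuous_measurable_fun (mI `[0, T]) ch).
have bh : [bounded h x | x in (`[0, T]%classic : set (measurableTypeR R))].
  have /compact_bounded[M [Mr hM]] := continuous_compact ch (@segment_compact _ 0 T).
  by exists M; split => // x Mx y yT /=; apply: (hM _ Mx); exists y.
have ih : m.-integrable `[0, T]%classic (EFin \o h).
  apply: measurable_bounded_integrable => //.
  by rewrite -ge0_fin_numE// fin_num_measure.
suff main j : (j <= n)%N ->
   `|\int[m]_(x in `[0, grid T n j]) h x - \sum_(k < j)
     h (grid T n k.+1) * fine (m `]grid T n k, grid T n k.+1]%classic)| <=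
  w * fine (m `[0, grid T n j]%classic).
  by have := main n (leqnn n); rewrite gridn.
elim: j => [|j ihj] jn.
  rewrite grid0 big_ord0 subr0 (eq_Rintegral _ (g := fun=> 0)); last first.
    by move=> x; rewrite inE/= in_itv/= => x0; rewrite -h0; congr h; apply/eqP; rewrite eq_le andbC.
  by rewrite Rintegral_cst// mul0r normr0 mulr_ge0// fine_ge0.
have g0 : 0 <= grid T n j by exact: grid_ge0.
have gj : grid T n j <= grid T n j.+1 by exact: grid_le.
have gT : grid T n j.+1 <= T by exact: grid_leT.
have E : `[0, grid T n j.+1]%classic =
    `[0, grid T n j]%classic `|` `]grid T n j, grid T n j.+1]%classic.
  by apply: itv_bndbnd_setU; rewrite bnd_simp.
have D : [disjoint `[0, grid T n j]%classic & `]grid T n j, grid T n j.+1]%classic].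
  apply/disj_set2P; rewrite -subset0 => x []/=; rewrite !in_itv/=.
  by move=> /andP[_ xc] /andP[cx _]; move: (lt_le_trans cx xc); rewrite ltxx.
have iE : m.-integrable `[0, grid T n j.+1]%classic (EFin \o h).
  apply: (integrableS _ _ _ ih) => //; apply: subset_itvl; by rewrite bnd_simp.
have iB : m.-integrable `]grid T n j, grid T n j.+1]%classic (EFin \o h).
  by apply: (integrableS _ _ _ iE) => //; rewrite E; exact: subsetUr.
have mE : fine (m `[0, grid T n j.+1]%classic) = fine (m `[0, grid T n j]%classic) +
   fine (m `]grid T n j, grid T n j.+1]%classic).
  rewrite E measureU//; last by apply/disj_set2P.
  by rewrite fineD// fin_num_measure.
rewrite mE mulrDr {1}E Rintegral_setU -?E// big_ord_recr/= opprD addrACA.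
rewrite (le_trans (ler_normD _ _))// lerD ?ihj ?(ltnW jn)//.
have ic : m.-integrable `]grid T n j, grid T n j.+1]%classic
    (EFin \o (fun=> h (grid T n j.+1))).
  by apply: finite_measure_integrable_cst.
rewrite -Rintegral_cst// -RintegralB//.
have id : m.-integrable `]grid T n j, grid T n j.+1]%classic
    (EFin \o (fun x => h x - h (grid T n j.+1))).
  by apply: (integrableB _ iB ic).
rewrite (le_trans (le_normr_Rintegral _ id))// -Rintegral_cst//.
apply: le_Rintegral => //.
- exact: integrable_norm id.
- by apply: finite_measure_integrable_cst.
- by move=> x; rewrite /= in_itv/= => /andP[/ltW ? ?]; exact: hw.
Qed.

End finite_measure_sums.

(** The constant [M] is the total variation of the charge, obtained from any of
    its Hahn decompositions. *)
Lemma charge_integral_approx (R : realType) (T : R)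
    (nu : {charge set (measurableTypeR R) -> \bar R}) :
  0 < T -> exists2 M : R, 0 <= M & forall (h : R -> R) (n : nat) (w : R),
  {within `[0, T], continuous h} -> h 0 = 0 -> (0 < n)%N ->
  (forall k x, (k < n)%N -> grid T n k <= x -> x <= grid T n k.+1 ->
     `|h x - h (grid T n k.+1)| <= w) ->
  `|charge_integral nu `[0, T]%classic h - \sum_(k < n)
     h (grid T n k.+1) * fine (nu `]grid T n k, grid T n k.+1]%classic)| <=
  w * M.
Proof.
move=> T0; rewrite /charge_integral.
set P := cid _; set N := cid _.
pose mp : {finite_measure set _ -> \bar R} := jordan_pos (projT2 N).
pose mn : {finite_measure set _ -> \bar R} := jordan_neg (projT2 N).
exists (fine (mp `[0, T]%classic) + fine (mn `[0, T]%classic)).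
  by rewrite addr_ge0// fine_ge0.
move=> h n w ch h0 n0 hw.
have hp := integral_grid_approx T0 mp ch h0 n0 hw.
have hn := integral_grid_approx T0 mn ch h0 n0 hw.
have nuE k : fine (nu `]grid T n k, grid T n k.+1]%classic) =
   fine (mp `]grid T n k, grid T n k.+1]%classic) -
   fine (mn `]grid T n k, grid T n k.+1]%classic).
  have mI : measurable (`]grid T n k, grid T n k.+1]%classic : set (measurableTypeR R)).
    exact: measurable_itv.
  rewrite (jordan_decomp (projT2 N) mI).
  rewrite (_ : cadd _ _ _ = mp `]grid T n k, grid T n k.+1]%classic +
      (-1)%:E * mn `]grid T n k, grid T n k.+1]%classic)%E//.
  by rewrite fineD ?fineM ?fin_num_measure ?fin_numM//= ?fin_num_measure//= mulN1r.
under eq_bigr do rewrite nuE mulrBr.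
rewrite sumrB mulrDr; move: hp hn.
set a := \int[_]_(_ in _) _; set b := \int[_]_(_ in _) _.
set s1 := \sum_(_ < _) _; set s2 := \sum_(_ < _) _ => hp hn.
rewrite (_ : a - b - (s1 - s2) = (a - s1) - (b - s2)); last by ring.
by rewrite (le_trans (ler_normB _ _))// lerD.
Qed.

(** * The Lebesgue-Stieltjes formula as a limit of grid sums *)

Lemma WB_modulus (R : realType) (H T w : R) : 0 < H -> 0 <= T -> 0 < w ->
  \forall n \near \oo, forall s k, 0 <= s <= T -> (k < n)%N ->
    WB H s (grid T n k.+1) - WB H s (grid T n k) <= w.
Proof.
move=> H0 T0 w0; have p0 : 0 < 2 * H by rewrite mulr_gt0.
have c1 : {within `[0, T], continuous (absp (2 * H))}.
  by apply: continuous_subspaceT; exact: continuous_absp.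
have c2 : {within `[- T, T], continuous (sabsp (2 * H))}.
  by apply: continuous_subspaceT; exact: continuous_sabsp.
have [d1 d10 h1] := compact_unif_cont (@segment_compact _ 0 T) c1 w0.
have [d2 d20 h2] := compact_unif_cont (@segment_compact _ (- T) T) c2 w0.
near=> n => s k sT kn; have /andP[s0 sT'] := sT.
have [n0 nd1] : (0 < n)%N /\ T / n%:R < d1 by near: n; exact: near_mesh.
have [_ nd2] : (0 < n)%N /\ T / n%:R < d2 by near: n; exact: near_mesh.
have g0 j : 0 <= grid T n j by exact: grid_ge0.
have gk : grid T n k.+1 <= T by exact: grid_leT.
have gk' : grid T n k <= T by apply: grid_leT => //; exact: ltnW.
have Tn : 0 <= T / n%:R by rewrite divr_ge0.
have e1 : absp (2 * H) (grid T n k.+1) - absp (2 * H) (grid T n k) <= w.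
  apply: (le_trans (ler_norm _)); apply/ltW/h1.
  - by rewrite /= in_itv/= g0.
  - by rewrite /= in_itv/= g0.
  - by rewrite /ball/= grid_step ger0_norm.
have e2 : sabsp (2 * H) (grid T n k.+1 - s) - sabsp (2 * H) (grid T n k - s) <= w.
  apply: (le_trans (ler_norm _)); apply/ltW/h2.
  - rewrite /= in_itv/=; have := g0 k.+1; lra.
  - rewrite /= in_itv/=; have := g0 k; lra.
  - rewrite /ball/= (_ : _ - _ - (_ - _) = grid T n k.+1 - grid T n k); last by ring.
    by rewrite grid_step ger0_norm.
rewrite /WB; lra.
Unshelve. all: by end_near. Qed.

Lemma RB_sym (R : realType) (H t s : R) : RB H t s = RB H s t.
Proof. by rewrite /RB distrC [t `^ _ + _]addrC. Qed.

Section ipB_limit.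
Context (R : realType) (H T : R) (vf vg f g : R -> R).
Hypotheses (H0 : 0 < H) (T0 : 0 < T).
Hypotheses (cf : controls T vf f) (cg : controls T vg g).

Let T0' : 0 <= T. Proof. exact: ltW. Qed.

Let F (s : R) := \int[lebesgue_measure]_(t in `[0, T]) (f t * dRB H t s).

Let Fn n (s : R) := \sum_(a < n)
  f (grid T n a) * (RB H (grid T n a.+1) s - RB H (grid T n a) s).

Let Vf := vf T - vf 0.
Let Vg := vg T - vg 0.
Let Vf0 : 0 <= Vf. Proof. by rewrite subr_ge0 (controls_le cf). Qed.
Let Vg0 : 0 <= Vg. Proof. by rewrite subr_ge0 (controls_le cg). Qed.

Let F_approx n w s : (0 < n)%N -> 0 <= s <= T ->
  (forall k, (k < n)%N -> WB H s (grid T n k.+1) - WB H s (grid T n k) <= w) ->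
  `|F s - Fn n s| <= w * Vf.
Proof.
move=> n0 /andP[s0 _] hw.
have prim a b : 0 <= a -> a <= b -> b <= T ->
    primitive_on (dRB H ^~ s) (RB H ^~ s) (WB H s) a b.
  by move=> a0 ab _; exact: primitive_dRB.
have [i e] := weighted_riemann T0' cf prim n0 hw.
suff -> : F s = \int[lebesgue_measure]_(t in `]0, T[) (f t * dRB H t s) by [].
by rewrite /F /Rintegral (integral_open_closed i).
Qed.

Let F_unif e : 0 < e -> \forall n \near \oo,
  (0 < n)%N /\ forall s, 0 <= s <= T -> `|F s - Fn n s| <= e.
Proof.
move=> e0; have w0 : 0 < e / (Vf + 1) by rewrite divr_gt0// ltr_pwDr.
near=> n.
have n0 : (0 < n)%N by near: n; exists 1%N.
split=> // s sT.
apply: (@le_trans _ _ (e / (Vf + 1) * Vf)).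
  apply: F_approx => // k kn.
  by move: s k sT kn; near: n; exact: WB_modulus.
by rewrite mulrAC ler_pdivrMr ?ltr_pwDr// ler_wpM2l ?lerDl// ltW.
Unshelve. all: by end_near. Qed.

Let Fn_continuous n : {within `[0, T], continuous (Fn n)}.
Proof.
have cRB := continuous_cov_RB H0.
have cR a : 0 <= a -> {within `[0, T], continuous (RB H a)}.
  move=> a0; have -> : RB H a = RB H ^~ a by apply/funext => s; exact: RB_sym.
  exact: (continuous_cov_slice cRB (lexx 0) a0).
have main m : {within `[0, T], continuous (fun s => \sum_(a < m)
    f (grid T n a) * (RB H (grid T n a.+1) s - RB H (grid T n a) s))}.
  elim: m => [|m ih].
    rewrite (_ : (fun s => _) = cst 0); last by apply/funext => s; rewrite big_ord0.
    by move=> x; exact: cvg_cst.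
  rewrite (_ : (fun s => _) = (fun s => \sum_(a < m)
    f (grid T n a) * (RB H (grid T n a.+1) s - RB H (grid T n a) s) +
    f (grid T n m) * (RB H (grid T n m.+1) s - RB H (grid T n m) s))); last first.
    by apply/funext => s; rewrite big_ord_recr.
  move=> x; apply: cvgD; first exact: ih.
  by apply: cvgMl_tmp; apply: cvgB; apply: cR; exact: grid_ge0.
exact: main.
Qed.

Let F_continuous : {within `[0, T], continuous F}.
Proof.
apply/subspace_continuousP => x xT; apply/cvgrPdist_lt => e e0.
have e3 : 0 < e / 3 by rewrite divr_gt0.
near \oo => n.
have [n0 hn] : (0 < n)%N /\ forall s, 0 <= s <= T -> `|F s - Fn n s| <= e / 3.
  by near: n; exact: F_unif.
have /subspace_continuousP /(_ x xT) /cvgrPdist_lt /(_ _ e3) := @Fn_continuous n.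
have := withinT `[0, T]%classic (nbhs_filter x).
apply: filterS2 => s sT hs.
have h1 : `|F x - Fn n x| <= e / 3 by apply: hn; move: xT; rewrite /= in_itv.
have h2 : `|F s - Fn n s| <= e / 3 by apply: hn; move: sT; rewrite /= in_itv.
change (`|F x - F s| < e); have {}hs : `|Fn n x - Fn n s| < e / 3 := hs.
move: h1 h2 hs; move: (F x) (F s) (Fn n x) (Fn n s) => a b c d h1 h2 hs.
rewrite (_ : a - b = (a - c) + (c - d) - (b - d)); last by ring.
rewrite (le_lt_trans (ler_normB _ _))//.
have := ler_normD (a - c) (c - d); move: hs; lra.
Unshelve. all: by end_near. Qed.

Let F0 : F 0 = 0.
Proof.
rewrite /F /Rintegral integral_itv_bndoo.
  rewrite integral0_eq// => t; rewrite /= in_itv/= => /andP[t0 _].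
  by rewrite dRBE ?gt_eqF// /dRBf subr0 subrr mulr0 mulr0.
apply/measurable_EFinP; apply: (eq_measurable_fun (fun _ : R => 0 : R)); last exact: measurable_cst.
move=> t.
rewrite inE/= in_itv/= => /andP[t0 _].
by rewrite dRBE ?gt_eqF// /dRBf subr0 subrr mulr0 mulr0.
Qed.

Let F_modulus e : 0 < e -> \forall n \near \oo, forall k x, (k < n)%N ->
  grid T n k <= x -> x <= grid T n k.+1 -> `|F x - F (grid T n k.+1)| <= e.
Proof.
move=> e0.
have [d d0 hd] := compact_unif_cont (@segment_compact _ 0 T) F_continuous e0.
near=> n => k x kn gx xg.
have [n0 nd] : (0 < n)%N /\ T / n%:R < d by near: n; exact: near_mesh.
have g0 j : 0 <= grid T n j by exact: grid_ge0.
have gT : grid T n k.+1 <= T by exact: grid_leT.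
apply/ltW/hd.
- by rewrite /= in_itv/= (le_trans (g0 k) gx) (le_trans xg gT).
- by rewrite /= in_itv/= g0.
- rewrite /ball/= distrC ger0_norm ?subr_ge0//; apply: le_lt_trans nd.
  by rewrite -(grid_step T n k) lerB.
Unshelve. all: by end_near. Qed.

Let G (x : R) := rlim (zero_ext T g) x.

(* The boundary terms vanish: [F 0 = 0], and [g] is extended by 0 beyond [T]. *)
Let abel n : (0 < n)%N ->
  \sum_(k < n) F (grid T n k.+1) * (G (grid T n k.+1) - G (grid T n k)) =
  - \sum_(k < n) G (grid T n k) * (F (grid T n k.+1) - F (grid T n k)).
Proof.
move=> n0; apply/eqP; rewrite -subr_eq0 opprK -big_split/=; apply/eqP.
transitivity (\sum_(0 <= k < n) (F (grid T n k.+1) * G (grid T n k.+1)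
    - F (grid T n k) * G (grid T n k))).
  rewrite big_mkord; apply: eq_bigr => k _.
  move: (F _) (F _) (G _) (G _) => a b c d; ring.
rewrite (telescope_sumr (fun k => F (grid T n k) * G (grid T n k)))//.
by rewrite grid0 gridn// F0 mul0r subr0 /G rlim_zero_extT mulr0.
Qed.

(** With [F s] the inner integral of [ipB], the double sums are Riemann-Stieltjes
    sums of [g] against the approximation [Fn n] of [F]. They are compared in turn
    with the sums of [g] against [F], with those of the right limits of [g]
    against [F], and, after a summation by parts, with the integral of [F]
    against the charge of [g]. *)
Lemma ipB_cvg :
  (\sum_(a < n) \sum_(c < n) f (grid T n a) * g (grid T n c) *
    rect (RB H) (grid T n a) (grid T n a.+1) (grid T n c) (grid T n c.+1))
   @[n --> \oo] --> ipB H T f g.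
Proof.
have [M M0 hM] := charge_integral_approx (LS_charge (zero_ext T g)) T0.
apply/cvgrPdist_le => e e0.
pose K := M + Vg + 2 * (`|g 0| + Vg) + 1.
have K0 : 0 < K by rewrite /K; have := normr_ge0 (g 0); have := Vg0; lra.
have eK : 0 < e / K by rewrite divr_gt0.
near=> n.
have [n0 hF] : (0 < n)%N /\ forall s, 0 <= s <= T -> `|F s - Fn n s| <= e / K.
  by near: n; exact: F_unif.
have hmod : forall k x, (k < n)%N ->
  grid T n k <= x -> x <= grid T n k.+1 -> `|F x - F (grid T n k.+1)| <= e / K.
  by near: n; exact: F_modulus.
have nuE k : (k < n)%N -> fine (LS_charge (zero_ext T g)
    `]grid T n k, grid T n k.+1]%classic) = G (grid T n k.+1) - G (grid T n k).
  by move=> kn; rewrite (LS_chargeP T0 cg)//; exact: grid_le.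
have h1 : `|ipB H T f g - \sum_(k < n) G (grid T n k) *
    (F (grid T n k.+1) - F (grid T n k))| <= e / K * M.
  have := hM F n (e / K) F_continuous F0 n0 hmod.
  under eq_bigr do rewrite nuE//.
  rewrite abel//.
  have -> : ipB H T f g = - charge_integral (LS_charge (zero_ext T g)) `[0, T]%classic F.
    by [].
  move: (charge_integral _ _ _) (\sum_(k < n) _) => u w h.
  by rewrite (_ : - u - w = - (u - - w)) ?normrN//; ring.
have h2 : `|\sum_(k < n) G (grid T n k) * (F (grid T n k.+1) - F (grid T n k)) -
    rs_sum T g F n| <= e / K * Vg.
  rewrite /rs_sum -sumrB (le_trans (ler_norm_sum _ _ _))//.
  have -> : Vg = \sum_(k < n) (vg (grid T n k.+1) - vg (grid T n k)).
    rewrite -(big_mkord xpredT (fun k => vg (grid T n k.+1) - vg (grid T n k))).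
    by rewrite (telescope_sumr (fun k => vg (grid T n k)))// grid0 gridn.
  rewrite mulr_sumr; apply: ler_sum => k _.
  rewrite -[g _ *: _]/(g _ * _) -mulrBl normrM mulrC.
  apply: ler_pM => //.
  - rewrite distrC; apply: hmod => //; exact: grid_le.
  - apply: rlim_zero_ext => //; [exact: grid_ge0| |exact: grid_leT].
    by rewrite -subr_gt0 grid_step divr_gt0// ltr0n.
have h3 : `|rs_sum T g F n - rs_sum T g (Fn n) n| <= e / K * (2 * (`|g 0| + Vg)).
  have -> : rs_sum T g F n - rs_sum T g (Fn n) n = rs_sum T g (fun s => F s - Fn n s) n.
    rewrite /rs_sum -sumrB; apply: eq_bigr => k _.
    rewrite -scalerBr; congr (_ *: _).
    move: (F _) (F _) (Fn _ _) (Fn _ _) => a b c d; ring.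
  rewrite mulrA [e / K * 2]mulrC.
  exact: (@rs_sum_le R T R^o vg g (fun s => F s - Fn n s) n (e / K) T0' cg hF).
have -> : \sum_(a < n) \sum_(c < n) f (grid T n a) * g (grid T n c) *
    rect (RB H) (grid T n a) (grid T n a.+1) (grid T n c) (grid T n c.+1) =
    rs_sum T g (Fn n) n.
  rewrite exchange_big/= /rs_sum; apply: eq_bigr => c _.
  rewrite /Fn -sumrB scaler_sumr; apply: eq_bigr => a _.
  by rewrite /rect /GRing.scale/=; ring.
set x1 := \sum_(k < n) _ in h1 h2; set x2 := rs_sum _ _ _ _ in h2 h3.
set x3 := rs_sum _ _ _ _ in h3 *.
move: (ipB H T f g) x1 x2 x3 h1 h2 h3 => x0 x1 x2 x3 h1 h2 h3.
rewrite (_ : x0 - x3 = (x0 - x1) + (x1 - x2) + (x2 - x3)); last by ring.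
apply: (@le_trans _ _ (e / K * (M + Vg + 2 * (`|g 0| + Vg)))).
  rewrite (_ : e / K * _ = e / K * M + e / K * Vg + e / K * (2 * (`|g 0| + Vg))); last by ring.
  by do 2 (apply: (le_trans (ler_normD _ _)); apply: lerD => //).
rewrite -[leRHS](divfK (lt0r_neq0 K0)) ler_wpM2l// ?(ltW eK)//.
by rewrite /K lerDl.
Unshelve. all: by end_near. Qed.

End ipB_limit.

(** * Tensors of functions of bounded variation *)

Lemma controls_sum (R : realType) (T : R) N (c : 'I_N -> R) (v f : 'I_N -> R -> R) :
  (forall i, controls T (v i) (f i)) ->
  controls T (fun x => \sum_i `|c i| * v i x) (fun x => \sum_i c i * f i x).
Proof.
move=> cf x y x0 xy yT; rewrite -!sumrB (le_trans (ler_norm_sum _ _ _))//.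
by apply: ler_sum => i _; rewrite -!mulrBr normrM ler_wpM2l// cf.
Qed.

Lemma cvg_sum_ord (R : realType) N (u : 'I_N -> nat -> R) (l : 'I_N -> R) :
  (forall i, u i n @[n --> \oo] --> l i) ->
  (\sum_i u i n) @[n --> \oo] --> \sum_i l i.
Proof.
elim: N u l => [|N ih] u l ul.
  rewrite big_ord0 (_ : (fun n => _) = cst 0); first exact: cvg_cst.
  by apply/funext => n; rewrite big_ord0.
rewrite big_ord_recr/= (_ : (fun n => _) = (fun n =>
    \sum_(i < N) u (widen_ord (leqnSn N) i) n + u ord_max n)); last first.
  by apply/funext => n; rewrite big_ord_recr.
by apply: cvgD; [apply: ih => i; exact: ul|exact: ul].
Qed.

Lemma controls_eq (R : realType) (T : R) (v f f' : R -> R) :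
  (forall x, 0 <= x <= T -> f x = f' x) -> controls T v f -> controls T v f'.
Proof.
move=> ff' cf x y x0 xy yT; rewrite -!ff'; first exact: cf.
- by rewrite x0 (le_trans xy).
- by rewrite yT (le_trans x0).
Qed.

Lemma controls_norm (R : realType) (T : R) (v f : R -> R) :
  controls T v f -> controls T v (fun x => `|f x|).
Proof.
move=> cf x y x0 xy yT; apply: le_trans (cf x y x0 xy yT).
exact: ler_dist_dist.
Qed.

Section tensors.
Context (R : realType) (T H : R).
Hypotheses (T0 : 0 < T) (H0 : 0 < H).
Let T0' : 0 <= T. Proof. exact: ltW. Qed.
Notation sq := (`[0, T]%classic `*` `[0, T]%classic).

Definition mass_sum2 (F : R -> R -> R) (n : nat) : R :=
  \sum_(a < n) \sum_(b < n) F (grid T n a) (grid T n b) *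
    (mass H (grid T n a) (grid T n a.+1) * mass H (grid T n b) (grid T n b.+1)).

Lemma mu2_tensor_cvg N (vf vg f g : 'I_N -> R -> R) (F : R -> R -> R) :
  (forall i, controls T (vf i) (f i)) -> (forall i, controls T (vg i) (g i)) ->
  (forall x y, 0 <= x <= T -> 0 <= y <= T ->
     F x y = `|\sum_i f i x * g i y|) ->
  exists2 m : R, mu2 H T F = m%:E & mass_sum2 F n @[n --> \oo] --> m.
Proof.
move=> cf cg FE.
pose bf i := `|f i 0| + (vf i T - vf i 0).
pose bg i := `|g i 0| + (vg i T - vg i 0).
apply: (mu2_cvg T0' H0 (v1 := fun x => \sum_i bg i * vf i x)
  (v2 := fun y => \sum_i bf i * vg i y)).
- move=> y yT; apply: (@controls_eq _ _ _ (fun x => `|\sum_i g i y * f i x|)).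
    by move=> x xT; rewrite FE//; congr `|_|; apply: eq_bigr => i _; rewrite mulrC.
  apply: controls_norm => x x' x0 xx' xT.
  apply: (le_trans (controls_sum (fun i => g i y) cf x0 xx' xT)).
  rewrite -!sumrB; apply: ler_sum => i _; rewrite -!mulrBr ler_wpM2r//.
    by rewrite subr_ge0 (controls_le (cf i)).
  exact: (controls_bounded (cg i)).
- move=> x xT; apply: (@controls_eq _ _ _ (fun y => `|\sum_i f i x * g i y|)).
    by move=> y yT; rewrite FE.
  apply: controls_norm => y y' y0 yy' yT.
  apply: (le_trans (controls_sum (fun i => f i x) cg y0 yy' yT)).
  rewrite -!sumrB; apply: ler_sum => i _; rewrite -!mulrBr ler_wpM2r//.
    by rewrite subr_ge0 (controls_le (cg i)).
  exact: (controls_bounded (cf i)).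
- by move=> x y xT yT; rewrite FE.
- apply: (eq_measurable_fun (fun z : measurableTypeR R * measurableTypeR R =>
    `|\sum_i (f i \o clamp T) z.1 * (g i \o clamp T) z.2|)).
    move=> [x y]; rewrite inE => -[]/=; rewrite !in_itv/= => xT yT.
    by rewrite FE//; congr `|_|; apply: eq_bigr => i _; rewrite !clamp_id.
  apply: measurable_funTS; apply: measurableT_comp; first exact: normr_measurable.
  apply: measurable_sum => i; apply: measurable_funM.
  + have mf : measurable_fun [set: measurableTypeR R] (f i \o clamp T).
      exact: (measurable_clamp T0' (cf i)).
    exact: (measurableT_comp mf measurable_fst).
  + have mg : measurable_fun [set: measurableTypeR R] (g i \o clamp T).
      exact: (measurable_clamp T0' (cg i)).
    exact: (measurableT_comp mg measurable_snd).
Qed.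

Definition cell (K : R -> R -> R) n (a c : nat) : R :=
  rect K (grid T n a) (grid T n a.+1) (grid T n c) (grid T n c.+1).

Definition ip_sum (K : R -> R -> R) (f g : R -> R) (n : nat) : R :=
  \sum_(a < n) \sum_(c < n) f (grid T n a) * g (grid T n c) * cell K n a c.

(** For a representation of [phi] and [psi] by simple tensors, this is the inner
    product of their step approximations; but it involves the values of [phi] and
    [psi] only, so that its limit does not depend on the representation. *)
Definition tensor_sum (K : R -> R -> R) (phi psi : R -> R -> R) (n : nat) : R :=
  \sum_(a < n) \sum_(c < n) \sum_(b < n) \sum_(e < n)
    phi (grid T n a) (grid T n b) * psi (grid T n c) (grid T n e) *
    (cell K n a c * cell K n b e).

Lemma tensor_sumE K N M (f g : 'I_N -> R -> R) (p q : 'I_M -> R -> R)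
    (phi psi : R -> R -> R) n :
  tensor_repr T phi f g -> tensor_repr T psi p q ->
  tensor_sum K phi psi n =
  \sum_i \sum_j ip_sum K (f i) (p j) n * ip_sum K (g i) (q j) n.
Proof.
move=> [_ hphi] [_ hpsi].
have gT (a : 'I_n) : 0 <= grid T n a <= T by rewrite grid_ge0//= grid_leT// ltnW.
have -> : \sum_i \sum_j ip_sum K (f i) (p j) n * ip_sum K (g i) (q j) n =
  \sum_i \sum_j \sum_(ac : 'I_n * 'I_n) \sum_(be : 'I_n * 'I_n)
    (f i (grid T n ac.1) * p j (grid T n ac.2) * cell K n ac.1 ac.2) *
    (g i (grid T n be.1) * q j (grid T n be.2) * cell K n be.1 be.2).
  apply: eq_bigr => i _; apply: eq_bigr => j _.
  rewrite /ip_sum ![in LHS]pair_bigA/= mulr_suml; apply: eq_bigr => ac _.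
  by rewrite mulr_sumr.
rewrite /tensor_sum.
transitivity (\sum_(ac : 'I_n * 'I_n) \sum_(be : 'I_n * 'I_n) \sum_i \sum_j
    (f i (grid T n ac.1) * p j (grid T n ac.2) * cell K n ac.1 ac.2) *
    (g i (grid T n be.1) * q j (grid T n be.2) * cell K n be.1 be.2)).
  rewrite [LHS]pair_bigA/=; apply: eq_bigr => ac _; rewrite [LHS]pair_bigA/=.
  apply: eq_bigr => be _; rewrite hphi// hpsi//.
  rewrite mulr_suml mulr_suml. apply: eq_bigr => i _.
  rewrite mulr_sumr mulr_suml; apply: eq_bigr => j _; ring.
under eq_bigr do rewrite exchange_big/=.
rewrite exchange_big/=; apply: eq_bigr => i _.
under eq_bigr do rewrite exchange_big/=.
by rewrite exchange_big/=.
Qed.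

Lemma ip_bv_class_cvg q K (E : step_completion T q) (f g : R -> R) :
  (forall a b c e, 0 <= a -> a <= b -> b <= T ->
    0 <= c -> c <= e -> e <= T -> q a b c e = rect K a b c e) ->
  continuous_cov K ->
  bounded_variation 0 T f -> bounded_variation 0 T g ->
  ip_sum K f g n @[n --> \oo] --> ip (bv_class E f) (bv_class E g).
Proof.
move=> qK cK bf bg.
have -> : ip_sum K f g = (fun n => ip (sc_class E (step_approx T f n))
    (sc_class E (step_approx T g n))).
  by apply/funext => n; rewrite (ip_step_approx T0' qK).
apply: cvg_ip.
- exact: (bv_class_cvg T0' qK cK bf).
- exact: (bv_class_cvg T0' qK cK bg).
Qed.

Lemma tensor_ip_cvg q K (E : step_completion T q) (E2 : tensor_square E)
    (phi psi : R -> R -> R) (h k : E2) :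
  (forall a b c e, 0 <= a -> a <= b -> b <= T ->
    0 <= c -> c <= e -> e <= T -> q a b c e = rect K a b c e) ->
  continuous_cov K -> tensor_class phi h -> tensor_class psi k ->
  tensor_sum K phi psi n @[n --> \oo] --> ip h k.
Proof.
move=> qK cK [N [f [g [rphi ->]]]] [M [p [r [rpsi ->]]]].
have -> : tensor_sum K phi psi = (fun n =>
    \sum_i \sum_j ip_sum K (f i) (p j) n * ip_sum K (g i) (r j) n).
  by apply/funext => n; exact: tensor_sumE.
rewrite ip_suml; under eq_bigr do rewrite ip_sumr.
have [bvp _] := rphi; have [bvs _] := rpsi.
apply: cvg_sum_ord => i; apply: cvg_sum_ord => j; rewrite tens_ip.
by apply: cvgM; apply: ip_bv_class_cvg => //;
  [apply: (bvp i).1|apply: (bvs j).1|apply: (bvp i).2|apply: (bvs j).2].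
Qed.

End tensors.

(** * Comparison of the quadruple sums *)

Lemma exchange_big4 (V : nmodType) n (F : 'I_n -> 'I_n -> 'I_n -> 'I_n -> V) :
  \sum_a \sum_c \sum_b \sum_e F a c b e = \sum_b \sum_e \sum_a \sum_c F a c b e.
Proof.
rewrite [LHS](pair_bigA _ (fun a c => \sum_b \sum_e F a c b e))/=.
under eq_bigr => x _ do rewrite (pair_bigA _ (fun b e => F x.1 x.2 b e))/=.
rewrite [RHS](pair_bigA _ (fun b e => \sum_a \sum_c F a c b e))/=.
under [RHS]eq_bigr => x _ do rewrite (pair_bigA _ (fun a c => F a c x.1 x.2))/=.
by rewrite exchange_big.
Qed.

Section discrete_comparison.
Context (R : realType) (T H C : R) (K L : R -> R -> R) (phi psi : R -> R -> R).
Hypotheses (T0 : 0 <= T) (H0 : 0 < H).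
Hypothesis KL : forall a b c e, 0 <= a -> a <= b -> b <= T ->
  0 <= c -> c <= e -> e <= T ->
  `|rect K a b c e - rect L a b c e| <= C * (mass H a b * mass H c e).
Hypothesis phi_sym : forall x y, 0 <= x <= T -> 0 <= y <= T -> phi x y = phi y x.
Hypothesis psi_sym : forall x y, 0 <= x <= T -> 0 <= y <= T -> psi x y = psi y x.

(** Writing the first kernel as the second one plus a perturbation, the
    difference of the two quadruple sums splits into a quadratic term and two
    linear terms, and symmetry identifies the linear terms with each other. *)
Lemma tensor_sum_diff n :
  `|tensor_sum T K phi psi n - tensor_sum T L phi psi n| <=
  C ^+ 2 * (mass_sum2 T H (fun x y => `|phi x y|) n *
            mass_sum2 T H (fun x y => `|psi x y|) n) +
  2 * C * mass_sum2 T H (fun x y => `|ip_sum T L (phi x) (psi y) n|) n.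
Proof.
pose t := grid T n; pose m (a : nat) := mass H (t a) (t a.+1).
pose l a c := cell T L n a c; pose d a c := cell T K n a c - l a c.
have gT (a : 'I_n) : 0 <= t a <= T by rewrite /t grid_ge0//= grid_leT// ltnW.
have dm (a c : 'I_n) : `|d a c| <= C * (m a * m c).
  by apply: KL; by [exact: grid_ge0|exact: grid_le|exact: grid_leT].
have m0 (a : 'I_n) : 0 <= m a by rewrite mass_ge0 ?grid_ge0 ?grid_le.
pose X1 := \sum_(a < n) \sum_(c < n) \sum_(b < n) \sum_(e < n)
  phi (t a) (t b) * psi (t c) (t e) * (d a c * d b e).
pose X2 := \sum_(a < n) \sum_(c < n) d a c * ip_sum T L (phi (t a)) (psi (t c)) n.
have X2E : X2 = \sum_(a < n) \sum_(c < n) \sum_(b < n) \sum_(e < n)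
    phi (t a) (t b) * psi (t c) (t e) * (d a c * l b e).
  apply: eq_bigr => a _; apply: eq_bigr => c _.
  rewrite /ip_sum mulr_sumr; apply: eq_bigr => b _.
  by rewrite mulr_sumr; apply: eq_bigr => e _; rewrite -/(l b e) -/t; ring.
have -> : tensor_sum T K phi psi n - tensor_sum T L phi psi n = X1 + 2 * X2.
  have X3E : X2 = \sum_(a < n) \sum_(c < n) \sum_(b < n) \sum_(e < n)
      phi (t a) (t b) * psi (t c) (t e) * (l a c * d b e).
    rewrite X2E exchange_big4; apply: eq_bigr => a _; apply: eq_bigr => c _.
    apply: eq_bigr => b _; apply: eq_bigr => e _.
    by rewrite [phi _ _]phi_sym// [psi _ _]psi_sym//; ring.
  rewrite mulr_natl mulr2n {1}X2E X3E /X1 -!big_split/= -sumrB.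
  apply: eq_bigr => a _; rewrite -!big_split/= -sumrB.
  apply: eq_bigr => c _; rewrite -!big_split/= -sumrB.
  apply: eq_bigr => b _; rewrite -!big_split/= -sumrB.
  by apply: eq_bigr => e _; rewrite /d -/(l a c) -/(l b e) -/t; ring.
rewrite (le_trans (ler_normD _ _))// lerD//.
- rewrite /mass_sum2 mulr_suml mulr_sumr (le_trans (ler_norm_sum _ _ _))//.
  apply: ler_sum => a _; rewrite mulr_suml mulr_sumr exchange_big/=.
  rewrite (le_trans (ler_norm_sum _ _ _))//.
  apply: ler_sum => b _; rewrite !mulr_sumr (le_trans (ler_norm_sum _ _ _))//.
  apply: ler_sum => c _; rewrite !mulr_sumr (le_trans (ler_norm_sum _ _ _))//.
  apply: ler_sum => e _; rewrite -/t -!/(m _) !normrM.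
  have dd : `|d a c| * `|d b e| <= (C * (m a * m c)) * (C * (m b * m e)).
    by apply: ler_pM.
  have pp : 0 <= `|phi (t a) (t b)| * `|psi (t c) (t e)| by rewrite mulr_ge0.
  apply: (le_trans (ler_wpM2l pp dd)); rewrite le_eqVlt; apply/orP; left.
  by apply/eqP; ring.
- rewrite normrM ger0_norm// -mulrA ler_wpM2l// /mass_sum2 mulr_sumr.
  rewrite (le_trans (ler_norm_sum _ _ _))//; apply: ler_sum => a _.
  rewrite mulr_sumr (le_trans (ler_norm_sum _ _ _))//; apply: ler_sum => c _.
  rewrite -/t -!/(m _) normrM.
  apply: (le_trans (ler_wpM2r _ (dm a c))) => //.
  rewrite le_eqVlt; apply/orP; left; apply/eqP; ring.
Qed.

End discrete_comparison.

Lemma tensor_repr_controls (R : realType) (T : R) N (phi : R -> R -> R)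
    (f g : 'I_N -> R -> R) : 0 <= T -> tensor_repr T phi f g ->
  exists vf vg, (forall i, controls T (vf i) (f i)) /\
                (forall i, controls T (vg i) (g i)).
Proof.
move=> T0 [bv _].
have [vf hf] := choice (fun i => bounded_variation_controls T0 (bv i).1).
have [vg hg] := choice (fun i => bounded_variation_controls T0 (bv i).2).
by exists vf, vg.
Qed.

Section contraction_limit.
Context (R : realType) (T H : R).
Hypotheses (T0 : 0 < T) (H0 : 0 < H).
Let T0' : 0 <= T. Proof. exact: ltW. Qed.

Lemma mass_sum2_const_cvg : exists m : R,
  mass_sum2 T H (fun _ _ => 1) n @[n --> \oo] --> m.
Proof.
have c1 : forall i : 'I_1, controls T (fun=> 0) (fun=> 1 : R).
  by move=> _ x y _ _ _; rewrite !subrr normr0.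
have e1 x y : 0 <= x <= T -> 0 <= y <= T -> 1 = `|\sum_(i < 1) (1 : R) * 1|.
  by move=> _ _; rewrite big_ord1 mul1r normr1.
have [m _ hm] := mu2_tensor_cvg T0 H0 c1 c1 e1.
by exists m.
Qed.

Lemma ip_sum_cvg (vf vg f g : R -> R) :
  controls T vf f -> controls T vg g ->
  ip_sum T (RB H) f g n @[n --> \oo] --> ipB H T f g.
Proof. by move=> cf cg; exact: (ipB_cvg H0 T0 cf cg). Qed.

Variables (phi psi : R -> R -> R).
Hypotheses (hphi : Vsym2 T phi) (hpsi : Vsym2 T psi).

(** The discrete contractions converge to the contraction uniformly, because
    they involve the points [x] and [y] through finitely many bounded functions
    only. *)
Lemma contraction_cvg : exists mA : R, exists u : nat -> R,
  [/\ mu2 H T (fun x y => `|contraction1 H T phi psi x y|) = mA%:E,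
      u n @[n --> \oo] --> mA &
      forall n, mass_sum2 T H (fun x y => `|ip_sum T (RB H) (phi x) (psi y) n|) n
        <= u n].
Proof.
have [[N [f [g rphi]]] _] := hphi; have [[M [p [q rpsi]]] _] := hpsi.
have [vf [vg [cf cg]]] := tensor_repr_controls T0' rphi.
have [vp [vq [cp cq]]] := tensor_repr_controls T0' rpsi.
have [_ phiE] := rphi; have [_ psiE] := rpsi.
pose al i j n := ip_sum T (RB H) (g i) (q j) n.
pose be i j := ipB H T (g i) (q j).
pose A n x y := ip_sum T (RB H) (phi x) (psi y) n.
have gT n (a : 'I_n) : 0 <= grid T n a <= T by rewrite grid_ge0//= grid_leT// ltnW.
have AE n x y : 0 <= x <= T -> 0 <= y <= T ->
    A n x y = \sum_i \sum_j f i x * p j y * al i j n.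
  move=> xT yT.
  transitivity (\sum_(a < n) \sum_(c < n) \sum_i \sum_j f i x * p j y *
     (g i (grid T n a) * q j (grid T n c) * cell T (RB H) n a c)).
    apply: eq_bigr => a _; apply: eq_bigr => c _.
    rewrite phiE// psiE// mulr_suml mulr_suml; apply: eq_bigr => i _.
    by rewrite mulr_sumr mulr_suml; apply: eq_bigr => j _; ring.
  under eq_bigr do rewrite exchange_big/=.
  rewrite exchange_big/=; apply: eq_bigr => i _.
  under eq_bigr do rewrite exchange_big/=.
  rewrite exchange_big/=; apply: eq_bigr => j _.
  rewrite /al /ip_sum mulr_sumr; apply: eq_bigr => a _.
  by rewrite mulr_sumr; apply: eq_bigr => c _.
have contrE x y : 0 <= x <= T -> 0 <= y <= T ->
    contraction1 H T phi psi x y = \sum_i \sum_j f i x * p j y * be i j.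
  move=> xT yT.
  have cphi : controls T (fun z => \sum_i `|f i x| * vg i z) (phi x).
    apply: (controls_eq _ (controls_sum (fun i => f i x) cg)) => z zT.
    by rewrite phiE.
  have cpsi : controls T (fun z => \sum_i `|p i y| * vq i z) (psi y).
    apply: (controls_eq _ (controls_sum (fun i => p i y) cq)) => z zT.
    by rewrite psiE.
  have h1 : A n x y @[n --> \oo] --> contraction1 H T phi psi x y.
    exact: (ip_sum_cvg cphi cpsi).
  have h2 : A n x y @[n --> \oo] --> \sum_i \sum_j f i x * p j y * be i j.
    have -> : (fun n => A n x y) = (fun n => \sum_i \sum_j f i x * p j y * al i j n).
      by apply/funext => n; exact: AE.
    apply: cvg_sum_ord => i; apply: cvg_sum_ord => j.
    by apply: cvgMl_tmp; exact: (ip_sum_cvg (cg i) (cq j)).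
  exact: (cvg_unique _ h1 h2).
have cg' i : controls T (fun y => \sum_j `|be i j| * vp j y)
    (fun y => \sum_j be i j * p j y) by exact: controls_sum.
have FE x y : 0 <= x <= T -> 0 <= y <= T -> `|contraction1 H T phi psi x y| =
    `|\sum_i f i x * (\sum_j be i j * p j y)|.
  move=> xT yT; rewrite contrE//; congr `|_|; apply: eq_bigr => i _.
  by rewrite mulr_sumr; apply: eq_bigr => j _; ring.
have [mA mAE hmA] := mu2_tensor_cvg T0 H0 cf cg' FE.
have [m1 hm1] := mass_sum2_const_cvg.
pose bf i := `|f i 0| + (vf i T - vf i 0).
pose bp j := `|p j 0| + (vp j T - vp j 0).
pose err n := \sum_i \sum_j bf i * bp j * `|al i j n - be i j|.
have err0 : err n @[n --> \oo] --> 0.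
  have -> : 0 = \sum_(i < N) \sum_(j < M) bf i * bp j * `|be i j - be i j|.
    by rewrite big1// => i _; rewrite big1// => j _; rewrite subrr normr0 mulr0.
  apply: cvg_sum_ord => i; apply: cvg_sum_ord => j.
  apply: cvgMl_tmp; apply: cvg_norm; apply: cvgB; last exact: cvg_cst.
  exact: (ip_sum_cvg (cg i) (cq j)).
exists mA, (fun n => mass_sum2 T H (fun x y => `|contraction1 H T phi psi x y|) n +
  err n * mass_sum2 T H (fun _ _ => 1) n); split => //.
  by rewrite -[X in _ --> X]addr0 -(mul0r m1); apply: cvgD hmA _; exact: cvgM.
move=> n; rewrite /mass_sum2 mulr_sumr -big_split/=; apply: ler_sum => a _.
rewrite mulr_sumr -big_split/=; apply: ler_sum => c _.
have mg (b : 'I_n) : 0 <= mass H (grid T n b) (grid T n b.+1).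
  by rewrite mass_ge0 ?grid_ge0 ?grid_le.
rewrite mul1r -mulrDl; apply: ler_wpM2r; first exact: mulr_ge0 (mg a) (mg c).
rewrite -lerBlDl; apply: (le_trans (ler_norm _)); apply: (le_trans (ler_dist_dist _ _)).
rewrite -/(A n _ _) AE// contrE// -sumrB (le_trans (ler_norm_sum _ _ _))//.
apply: ler_sum => i _; rewrite -sumrB (le_trans (ler_norm_sum _ _ _))//.
apply: ler_sum => j _; rewrite -mulrBr !normrM ler_wpM2r//.
apply: ler_pM => //; [exact: (controls_bounded (cf i))|exact: (controls_bounded (cp j))].
Qed.

End contraction_limit.

(** * The comparison theorem *)

Theorem proposition2p4 (R : realType) (d : measure_display)
    (Omega : measurableType d) (P : probability Omega R)
    (G : R -> {RV P >-> R}) (T H C : R)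
    (hG : gaussian_process G) (hG0 : centered_process G)
    (hGc : continuous_process G) (hR : continuous_cov (cov G))
    (hT : 0 < T) (hH : 0 < H < 2^-1 \/ 2^-1 < H < 1)
    (hA : hypA (cov G) H T C)
    (E : step_completion T (incr_cov G)) (E2 : tensor_square E)
    (E1 : step_completion T (incr_covB H)) (E12 : tensor_square E1)
    (phi psi : R -> R -> R) (hphi : Vsym2 T phi) (hpsi : Vsym2 T psi)
    (h k : E2) (hh : tensor_class phi h) (hk : tensor_class psi k)
    (h1 k1 : E12) (hh1 : tensor_class phi h1) (hk1 : tensor_class psi k1) :
  (`|ip h k - ip h1 k1|%:E <=
     (C ^+ 2)%:E * mu2 H T (fun x y => `|phi x y|%R)
                 * mu2 H T (fun x y => `|psi x y|%R)
     + (2 * C)%:E * mu2 H T (fun x y => `|contraction1 H T phi psi x y|%R))%E.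
Proof.
have H0 : 0 < H.
  by case: hH => /andP[] // /(lt_trans _)-> //; rewrite invr_gt0.
have T0 := ltW hT.
have lim1 := tensor_ip_cvg hT (fun a b c e a0 ab _ c0 ce _ =>
  incr_covE hG a0 (le_trans a0 ab) c0 (le_trans c0 ce)) hR hh hk.
have lim2 := @tensor_ip_cvg _ _ hT _ _ E1 E12 phi psi h1 k1
  (fun a b c e _ _ _ _ _ _ => erefl) (continuous_cov_RB H0) hh1 hk1.
have tensor_mu2 F : Vsym2 T F -> exists2 m : R,
    mu2 H T (fun x y => `|F x y|) = m%:E &
    mass_sum2 T H (fun x y => `|F x y|) n @[n --> \oo] --> m.
  move=> [[N [f [g rF]]] _].
  have [vf [vg [cf cg]]] := tensor_repr_controls T0 rF.
  by apply: (mu2_tensor_cvg hT H0 cf cg) => x y xT yT; rewrite (proj2 rF).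
have [mphi -> lphi] := tensor_mu2 phi hphi.
have [mpsi -> lpsi] := tensor_mu2 psi hpsi.
have [mA [u [-> lu uge]]] := contraction_cvg hT H0 hphi hpsi.
rewrite -!EFinM -EFinD lee_fin.
have C0 : 0 <= C := hypA_C hA.
rewrite -[C ^+ 2 * mphi * mpsi]mulrA.
apply: (ler_cvg_to (f := fun n => `|tensor_sum T (cov G) phi psi n -
     tensor_sum T (RB H) phi psi n|) (g := fun n =>
     C ^+ 2 * (mass_sum2 T H (fun x y => `|phi x y|) n *
       mass_sum2 T H (fun x y => `|psi x y|) n) + 2 * C * u n) (a := \oo)).
- by apply: cvg_norm; exact: cvgB.
- by apply: cvgD; apply: cvgMl_tmp => //; exact: cvgM.
- near=> n.
  have [_ sphi] := hphi; have [_ spsi] := hpsi.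
  apply: (le_trans (tensor_sum_diff T0 H0
    (rect_bound H0 hR hA) sphi spsi n)).
  by rewrite lerD2l ler_wpM2l ?mulr_ge0.
Unshelve. all: by end_near. Qed.
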